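(* Let $\Pi$, $Q$ be probability distributions on $\mathbb{R}^d$ with Lebesgue densities $\pi$, $q$ having support $\Theta$, and let $P$ be the Metropolis-Hastings independence kernel with target $\Pi$ and proposal $Q$ (as in the context). Let $\|\cdot\|$ be any norm on $\mathbb{R}^d$. If $\pi$ and $q$ are locally Lipschitz continuous and bounded on $\mathbb{R}^d$ and there exists a solution $\theta^* = \operatorname{argmin}\{ q(\theta)/\pi(\theta) : \theta \in \Theta\}$ (i.e. a point $\theta^*\in\Theta$ at which $q/\pi$ attains its minimum over $\Theta$), then for any $\theta \in \Theta$ the Wasserstein convergence rate is the same, with $$r_{\min\{\|\cdot\|, 1\}}(\theta) = \lim_{t\to\infty} \mathcal{W}_{\min\{\|\cdot\|,1\}}(P^t(\theta,\cdot),\Pi)^{1/t} = 1 - \frac{q(\theta^* )}{\pi(\theta^* )}.$$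
   Context: Setting: $\Theta \subseteq \mathbb{R}^d$ is a nonempty measurable set. $\Pi$ (target) and $Q$ (proposal) are probability distributions on $\mathbb{R}^d$ with $Q \ne \Pi$, with Lebesgue densities $\pi$ and $q$ respectively, both with support $\Theta$, meaning that $\pi$ and $q$ are strictly positive on $\Theta$ and zero outside $\Theta$. Metropolis-Hastings independence (MHI) kernel: define $a(\theta,\theta') = \min\left\{ \frac{\pi(\theta') q(\theta)}{\pi(\theta) q(\theta')}, 1\right\}$ if $\pi(\theta) q(\theta') > 0$ and $a(\theta,\theta') = 1$ if $\pi(\theta) q(\theta') = 0$. For $\theta \in \mathbb{R}^d$ and measurable $B \subseteq \mathbb{R}^d$, $$P(\theta, B) = \int_B a(\theta,\theta') q(\theta')\, d\theta' + \delta_\theta(B)\left(1 - \int a(\theta,\theta') q(\theta')\, d\theta'\right),$$ where $\delta_\theta$ is the Dirac measure at $\theta$; $P^1 = P$ and $P^t(\theta,B) = \int P(\theta, d\theta') P^{t-1}(\theta', B)$ for $t \ge 2$. Wasserstein distance: for a metric $\rho$, $\mathcal{W}_\rho(\mu,\nu) = \inf_{\xi \in \mathcal{C}(\mu,\nu)} \int \rho(\theta,\omega)\, d\xi(\theta,\omega)$, where $\mathcal{C}(\mu,\nu)$ is the set of joint probability measures with marginals $\mu$ and $\nu$. The subscript $\min\{\|\cdot\|,1\}$ denotes the metric $\rho(\theta,\omega) = \min\{\|\theta-\omega\|,1\}$. The Wasserstein convergence rate at $\theta\in\Theta$ is $r_\rho(\theta) = \lim_{t\to\infty}\mathcal{W}_\rho(P^t(\theta,\cdot),\Pi)^{1/t}$;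 the claim includes that the limit exists. *)

(* Defs.v *)
From HB Require Import structures.
From mathcomp Require Import all_boot all_order all_algebra.
From mathcomp Require Import all_classical all_reals all_analysis.
From mathcomp Require Import measurable_realfun.
Set Implicit Arguments.
Unset Strict Implicit.
Unset Printing Implicit Defensive.
Import Order.TTheory GRing.Theory Num.Theory.
Import numFieldNormedType.Exports.
Local Open Scope classical_set_scope.
Local Open Scope ring_scope.

(* 'rV[R]_n carries the sigma-algebra generated by the coordinates, as the
   library does for n.-tuple R; for R : realType it is the Borel one. *)

Definition rV_display : measure_display -> measure_display.
Proof. exact. Qed.

Section measurable_rV.
Context {d} {T : measurableType d}.
Variable n : nat.

Let coord (i : 'I_n) (x : 'rV[T]_n) : T := x ord0 i.

Let rV_set0 : g_sigma_preimage coord set0.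
Proof. exact: sigma_algebra0. Qed.

Let rV_setC A : g_sigma_preimage coord A -> g_sigma_preimage coord (~` A).
Proof. exact: sigma_algebraC. Qed.

Let rV_bigcup (F : _^nat) : (forall i, g_sigma_preimage coord (F i)) ->
  g_sigma_preimage coord (\bigcup_i (F i)).
Proof. exact: sigma_algebra_bigcup. Qed.

HB.instance Definition _ := @isMeasurable.Build (rV_display d)
  'rV[T]_n (g_sigma_preimage coord) rV_set0 rV_setC rV_bigcup.

Lemma measurable_coord (i : 'I_n) :
  measurable_fun [set: 'rV[T]_n] (fun x : 'rV[T]_n => x ord0 i).
Proof.
move=> _ Y mY; rewrite setTI; apply: sub_sigma_algebra => /=.
rewrite -bigcup_seq/=; exists i => /=; first by rewrite mem_index_enum.
by exists Y => //; rewrite setTI.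
Qed.

End measurable_rV.

Lemma measurable_fun_rV d1 d2 (T1 : measurableType d1) (T2 : measurableType d2)
    n (f : T1 -> 'rV[T2]_n) :
  (forall i, measurable_fun [set: T1] (fun x => f x ord0 i)) ->
  measurable_fun [set: T1] f.
Proof.
move=> mf.
have h : g_sigma_preimage (fun i => (fun x : 'rV[T2]_n => x ord0 i) \o f)
    `<=` measurable.
  apply: smallest_sub; first exact: sigma_algebra_measurable.
  case: n => [|n] in f mf *; first by rewrite big_ord0.
  rewrite -bigcup_mkord_ord; apply: bigcup_sub => i Ii.
  by move=> A [B mB <-]; exact: mf.
rewrite g_sigma_preimage_comp in h.
by move=> _ A mA; apply: h; exists A.
Qed.

Section lebesgue_rV.
Variable R : realType.

Let TR : measurableType _ := measurableTypeR R.

Definition rV_cons n (p : TR * 'rV[R]_n) : 'rV[R]_n.+1 :=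
  \row_i if unlift ord0 i is Some j then p.2 ord0 j else p.1.

Definition rV_uncons n (x : 'rV[R]_n.+1) : TR * 'rV[R]_n :=
  (x ord0 ord0, \row_j x ord0 (lift ord0 j)).

Lemma rV_cons0 n (p : TR * 'rV[R]_n) : rV_cons p ord0 ord0 = p.1.
Proof. by rewrite mxE unlift_none. Qed.

Lemma rV_consS n (p : TR * 'rV[R]_n) (j : 'I_n) :
  rV_cons p ord0 (lift ord0 j) = p.2 ord0 j.
Proof. by rewrite mxE liftK. Qed.

Lemma rV_consK n : cancel (@rV_cons n) (@rV_uncons n).
Proof.
move=> [x v]; rewrite /rV_uncons rV_cons0; congr pair.
by apply/rowP => j; rewrite mxE rV_consS.
Qed.

Lemma measurable_rV_cons n : measurable_fun setT (@rV_cons n).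
Proof.
apply: measurable_fun_rV => i; case: (unliftP ord0 i) => [j|] ->.
  under eq_fun do rewrite rV_consS.
  apply: (measurableT_comp (f := fun x : 'rV[R]_n => x ord0 j)) => //.
  exact: measurable_coord.
under eq_fun do rewrite rV_cons0.
exact: (@measurable_fst _ _ TR 'rV[R]_n).
Qed.

Lemma measurable_rV_uncons n : measurable_fun setT (@rV_uncons n).
Proof.
apply/measurable_fun_pairP; split; first exact: measurable_coord.
apply: measurable_fun_rV => i /=.
under eq_fun do rewrite mxE.
exact: measurable_coord.
Qed.

HB.instance Definition _ n :=
  isMeasurableFun.Build _ _ _ _ (@rV_cons n) (@measurable_rV_cons n).

Section step.
Local Open Scope ereal_scope.
Variables (n : nat) (m : {sigma_finite_measure set 'rV[R]_n -> \bar R}).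

Definition lebesgue_rV_step : set 'rV[R]_n.+1 -> \bar R :=
  pushforward (lebesgue_measure \x m) (@rV_cons n).

Let step0 : lebesgue_rV_step set0 = 0.
Proof. by rewrite /lebesgue_rV_step /pushforward preimage_set0 measure0. Qed.

Let step_ge0 A : 0 <= lebesgue_rV_step A.
Proof. exact: (measure_ge0 (lebesgue_measure \x m)). Qed.

Let step_sigma_additive : semi_sigma_additive lebesgue_rV_step.
Proof.
move=> F mF tF mUF; rewrite /lebesgue_rV_step /pushforward preimage_bigcup.
have mcons A : measurable A -> measurable (@rV_cons n @^-1` A).
  by move=> mA; rewrite -[X in measurable X]setTI; exact: measurable_rV_cons.
apply: measure_semi_sigma_additive.
- by move=> k; exact: mcons.
- apply/trivIsetP => /= i j _ _ ij; rewrite -preimage_setI.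
  by move/trivIsetP : tF => /(_ _ _ _ _ ij) ->//; rewrite preimage_set0.
- by rewrite -preimage_bigcup; exact: mcons.
Qed.

HB.instance Definition _ := isMeasure.Build _ _ _ lebesgue_rV_step
  step0 step_ge0 step_sigma_additive.

Let step_sigma_finite : sigma_finite setT lebesgue_rV_step.
Proof.
have /sigma_finiteP[F [TF ndF Foo]] :=
  sigma_finiteT (lebesgue_measure : {sigma_finite_measure set TR -> \bar R}).
have /sigma_finiteP[G [TG ndG Goo]] := sigma_finiteT m.
exists (fun k => @rV_uncons n @^-1` (F k `*` G k)).
  rewrite -preimage_bigcup (_ : \bigcup_k _ = setT) ?preimage_setT//.
  rewrite -setXTT TF TG predeqE => -[x y]; split.
    by move=> [k _ []/= ? ?]; split; exists k.
  move=> [/= [k _ Fkx] [l _ Gly]]; exists (maxn k l) => //; split.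
  - by move: x Fkx; exact/subsetPset/ndF/leq_maxl.
  - by move: y Gly; exact/subsetPset/ndG/leq_maxr.
move=> k; have [mF Fk] := Foo k; have [mG Gk] := Goo k; split.
  rewrite -[X in measurable X]setTI; apply: measurable_rV_uncons => //.
  exact: measurableX.
rewrite /lebesgue_rV_step /pushforward (_ : _ @^-1` _ = F k `*` G k).
  by rewrite product_measure1E// lte_mul_pinfty// ge0_fin_numE.
by apply/funext => x; rewrite /preimage /mkset rV_consK.
Qed.

HB.instance Definition _ := Measure_isSigmaFinite.Build _ _ _ lebesgue_rV_step
  step_sigma_finite.

End step.

(* d-dimensional Lebesgue measure, as the iterated product of the measure on R
   transported along (x, v) |-> x :: v. *)
Fixpoint lebesgue_rV n : {sigma_finite_measure set 'rV[R]_n -> \bar R} :=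
  if n is n'.+1 then lebesgue_rV_step (lebesgue_rV n') else \d_(0 : 'rV[R]_0).

Lemma lebesgue_rV_box n (B : 'I_n -> set R) : (forall i, measurable (B i)) ->
  lebesgue_rV n [set x | forall i, B i (x ord0 i)] =
  (\prod_(i < n) lebesgue_measure (B i))%E.
Proof.
elim: n B => [|n IH] B mB.
  rewrite big_ord0 /= diracE mem_set//.
  by case.
rewrite big_ord_recl -[LHS]/((lebesgue_measure \x lebesgue_rV n)%E (@rV_cons n @^-1` _)).
have -> : @rV_cons n @^-1` [set x | forall i, B i (x ord0 i)] =
    (B ord0 : set TR) `*` [set x : 'rV[R]_n | forall i, B (lift ord0 i) (x ord0 i)].
  apply/seteqP; split=> [[x v] /= h|[x v] /= [h0 h] i].
    split; first by have := h ord0; rewrite rV_cons0.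
    by move=> i; have := h (lift ord0 i); rewrite rV_consS.
  by case: (unliftP ord0 i) => [j|] ->; rewrite ?rV_consS ?rV_cons0.
have mB' : measurable [set x : 'rV[R]_n | forall i, B (lift ord0 i) (x ord0 i)].
  have -> : [set x : 'rV[R]_n | forall i, B (lift ord0 i) (x ord0 i)] =
      \bigcap_i [set x : 'rV[R]_n | B (lift ord0 i) (x ord0 i)].
    by apply/seteqP; split=> x /= h => [i _|i]; exact: h.
  apply: fin_bigcap_measurable => // i _.
  by rewrite -[X in measurable X]setTI; exact: measurable_coord.
have mB0 : @measurable _ TR (B ord0) by exact: mB.
rewrite (product_measure1E _ _ mB0 mB'); congr (_ * _)%E.
by rewrite -IH.
Qed.

End lebesgue_rV.

Section metropolis_hastings_independence.
Context {R : realType} {d : nat}.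
Local Notation T := 'rV[R]_d.
Local Notation leb := (lebesgue_rV R d).

Definition has_density (P : set T -> \bar R) (f : T -> R) : Prop :=
  [/\ measurable_fun setT f, forall x, 0 <= f x &
      forall A, measurable A -> P A = (\int[leb]_(x in A) (f x)%:E)%E].

Definition has_support (f : T -> R) (Theta : set T) : Prop :=
  (forall x, Theta x -> 0 < f x) /\ (forall x, ~ Theta x -> f x = 0).

Definition mhi_accept (pi q : T -> R) (x y : T) : R :=
  if 0 < pi x * q y then Num.min (pi y * q x / (pi x * q y)) 1 else 1.

Section kernel.
Variables (Pi Q : probability T R) (pi q : T -> R).
Hypotheses (hpi : has_density Pi pi) (hq : has_density Q q).
Local Open Scope ereal_scope.

Let mpi : measurable_fun setT pi. Proof. by case: hpi. Qed.
Let pi_ge0 x : (0 <= pi x)%R. Proof. by case: hpi. Qed.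
Let mq : measurable_fun setT q. Proof. by case: hq. Qed.
Let q_ge0 x : (0 <= q x)%R. Proof. by case: hq. Qed.

Let int_q : \int[leb]_y (q y)%:E = 1.
Proof. by case: hq => _ _ /(_ setT measurableT) <-; exact: probability_setT. Qed.

Let aq (x y : T) : R := (mhi_accept pi q x y * q y)%R.

Let accept_ge0 x y : (0 <= mhi_accept pi q x y)%R.
Proof.
rewrite /mhi_accept; case: ifP => // _.
by rewrite le_min ler01 andbT divr_ge0// mulr_ge0.
Qed.

Let accept_le1 x y : (mhi_accept pi q x y <= 1)%R.
Proof. by rewrite /mhi_accept; case: ifP => // _; rewrite ge_min lexx orbT. Qed.

Let aq_ge0 x y : (0 <= aq x y)%R.
Proof. by rewrite mulr_ge0. Qed.

Let measurable_aq2 : measurable_fun setT (fun z : T * T => aq z.1 z.2).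
Proof.
have mpi1 : measurable_fun setT (fun z : T * T => pi z.1).
  exact: (measurableT_comp mpi).
have mpi2 : measurable_fun setT (fun z : T * T => pi z.2).
  exact: (measurableT_comp mpi).
have mq1 : measurable_fun setT (fun z : T * T => q z.1).
  exact: (measurableT_comp mq).
have mq2 : measurable_fun setT (fun z : T * T => q z.2).
  exact: (measurableT_comp mq).
have mden : measurable_fun setT (fun z : T * T => pi z.1 * q z.2)%R.
  exact: measurable_funM.
apply: measurable_funM => //; apply: measurable_fun_ifT.
- exact: measurable_fun_ltr.
- apply: measurable_minr => //; apply: measurable_funM.
    exact: measurable_funM.
  rewrite (_ : (fun _ => _) =
      (fun z : T * T => (pi z.1 * q z.2) `^ (-1))%R); last first.
    by apply/funext => z; rewrite powR_inv1// mulr_ge0.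
  exact: (measurableT_comp (measurable_powR _) mden).
- exact: measurable_cst.
Qed.

Let measurable_aq x : measurable_fun setT (aq x).
Proof. exact: (measurableT_comp measurable_aq2 (measurable_pair1 x)). Qed.

Let int_aq_le1 x : \int[leb]_y (aq x y)%:E <= 1.
Proof.
rewrite -int_q; apply: ge0_le_integral => //.
- by move=> y _; rewrite lee_fin.
- exact/measurable_EFinP.
- exact/measurable_EFinP.
- by move=> y _; rewrite lee_fin ler_piMl.
Qed.

Let measurable_int_aq U : measurable U ->
  measurable_fun setT (fun x => \int[leb]_(y in U) (aq x y)%:E).
Proof.
move=> mU.
under eq_fun do rewrite integral_mkcond.
have := @measurable_fun_fubini_tonelli_F _ _ T T R leb
  (fun z => ((fun y => (aq z.1 y)%:E) \_ U) z.2).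
apply.
  rewrite (_ : (fun z => _) =
     (fun z : T * T => (aq z.1 z.2)%:E * (\1_U z.2)%:E)); last first.
    apply/funext => z; rewrite patchE indicE.
    by case: ifPn => _; rewrite ?mule1 ?mule0.
  apply: emeasurable_funM; first exact/measurable_EFinP.
  apply/measurable_EFinP; exact: (measurableT_comp (measurable_indic (R := R) mU) measurable_snd).
by move=> z; rewrite patchE; case: ifPn => // _; rewrite lee_fin.
Qed.

(* The density proofs do not occur in the body; they are parameters so that the
   instances below can find them. *)
Definition mhi_fun of has_density Pi pi & has_density Q q :=
  fun (x : T) (B : set T) =>
  \int[leb]_(y in B) (mhi_accept pi q x y * q y)%:E +
  \d_x B * (1 - \int[leb]_y (mhi_accept pi q x y * q y)%:E).

Local Notation k := (mhi_fun hpi hq).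

Let rej_ge0 x : 0 <= 1 - \int[leb]_y (aq x y)%:E.
Proof. by rewrite sube_ge0 ?int_aq_le1// orbT. Qed.

Let int_aq_fin x : \int[leb]_y (aq x y)%:E \is a fin_num.
Proof.
rewrite ge0_fin_numE; first exact: le_lt_trans (int_aq_le1 x) (ltry _).
by apply: integral_ge0 => y _; rewrite lee_fin.
Qed.

Let rej_fin x : 1 - \int[leb]_y (aq x y)%:E \is a fin_num.
Proof. by rewrite fin_numB int_aq_fin. Qed.

Let k0 x : k x set0 = 0.
Proof. by rewrite /mhi_fun integral_set0 measure0 mul0e adde0. Qed.

Let k_ge0 x A : 0 <= k x A.
Proof.
rewrite /mhi_fun adde_ge0//; last by rewrite mule_ge0 ?rej_ge0.
by apply: integral_ge0 => y _; rewrite lee_fin aq_ge0.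
Qed.

Let k_sigma_additive x : semi_sigma_additive (k x).
Proof.
move=> F mF tF mUF; rewrite /mhi_fun.
rewrite (_ : (fun n => _) = (fun n =>
    \sum_(0 <= i < n) \int[leb]_(y in F i) (aq x y)%:E +
    (\sum_(0 <= i < n) \d_x (F i)) * (1 - \int[leb]_y (aq x y)%:E))); last first.
  apply/funext => n; rewrite big_split/=; congr (_ + _).
  by rewrite ge0_sume_distrl.
apply: cvgeD.
- apply: ge0_adde_def; rewrite inE; last by rewrite mule_ge0 ?rej_ge0.
  by apply: integral_ge0 => y _; rewrite lee_fin aq_ge0.
- apply: (@semi_sigma_additive_nng_induced _ _ _ leb (fun y => (aq x y)%:E)) => //.
    exact/measurable_EFinP.
  by move=> y; rewrite lee_fin aq_ge0.
- apply: (cvgeZr (rej_fin x)).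
  exact: (@measure_semi_sigma_additive _ _ _ \d_x).
Qed.

HB.instance Definition _ x := isMeasure.Build _ _ _ (k x)
  (k0 x) (k_ge0 x) (@k_sigma_additive x).

Definition mhi (x : T) : {measure set T -> \bar R} := k x.

Let measurable_mhi U : measurable U -> measurable_fun setT (mhi ^~ U).
Proof.
move=> mU; apply: emeasurable_funD; first exact: measurable_int_aq.
apply: emeasurable_funM; first exact: measurable_fun_dirac.
by apply: emeasurable_funB => //; exact: measurable_int_aq.
Qed.

HB.instance Definition _ := isKernel.Build _ _ _ _ _ mhi measurable_mhi.

Let mhiT x : mhi x setT = 1.
Proof. by rewrite /mhi/= /mhi_fun diracT mul1e addeC subeK ?int_aq_fin. Qed.

HB.instance Definition _ := Kernel_isProbability.Build _ _ _ _ _ mhi mhiT.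

End kernel.
End metropolis_hastings_independence.

Section kernel_power.
Context d0 (X : measurableType d0) {R : realType}.
Local Open Scope ereal_scope.

Lemma prob_mkcomp_noparam (k1 k2 : R.-pker X ~> X) x :
  mkcomp_noparam k1 k2 x setT = 1.
Proof.
rewrite /mkcomp_noparam /= /kcomp_noparam.
under eq_integral do rewrite prob_kernel.
by rewrite integral_cst// mul1e prob_kernel.
Qed.

HB.instance Definition _ (k1 k2 : R.-pker X ~> X) :=
  isProbabilityKernel.Build _ _ _ _ _ (mkcomp_noparam k1 k2)
    (prob_mkcomp_noparam k1 k2).

Fixpoint kernel_pow (P : R.-pker X ~> X) (t : nat) : R.-pker X ~> X :=
  match t with
  | 0 => kdirac (@measurable_id _ X setT)
  | 1 => P
  | t'.+1 => mkcomp_noparam P (kernel_pow P t')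
  end.

End kernel_power.

Section wasserstein.
Context d0 (X : measurableType d0) {R : realType}.
Local Open Scope ereal_scope.

(* mu and nu are set functions; only their values on measurable sets matter. *)
Definition coupling (mu nu : set X -> \bar R) : set (probability (X * X)%type R) :=
  [set xi | (forall A, measurable A -> xi (A `*` setT) = mu A) /\
            (forall B, measurable B -> xi (setT `*` B) = nu B)].

Definition wasserstein (rho : X -> X -> R) (mu nu : set X -> \bar R) : \bar R :=
  ereal_inf [set \int[xi]_z (rho z.1 z.2)%:E | xi in coupling mu nu].

Definition wasserstein_root (rho : X -> X -> R) (P : R.-pker X ~> X)
    (Pi : set X -> \bar R) (x : X) (t : nat) : \bar R :=
  wasserstein rho (kernel_pow P t x) Pi `^ (t%:R^-1).

Definition wasserstein_rate rho P Pi x : \bar R :=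
  limn (wasserstein_root rho P Pi x).

End wasserstein.

Section norms.
Context {R : realType} {d : nat}.

(* Nonnegativity of N follows from the other axioms. *)
Definition is_norm (N : 'rV[R]_d -> R) : Prop :=
  [/\ forall x, N x = 0 -> x = 0,
      forall a x, N (a *: x) = `|a| * N x &
      forall x y, N (x + y) <= N x + N y].

Definition min1_dist (N : 'rV[R]_d -> R) (x y : 'rV[R]_d) : R :=
  Num.min (N (x - y)) 1.

(* Stated with the sup norm of 'rV[R]_d; all norms on R^d give the same notion. *)
Definition locally_lipschitz (f : 'rV[R]_d -> R) : Prop :=
  forall x : 'rV[R]_d, exists2 U, nbhs x U & [lipschitz f y | y in U].

End norms.

(* Main.v *)
(** Write [eps = q(theta* )/pi(theta* )] and [rho = 1 - eps]. Since
    [q >= eps * pi], the kernel dominates [eps * Pi] and [Pi] is invariant, so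
    [P^t(x, .) >= (1 - rho^t) Pi]; coupling the common part on the diagonal
    gives [W <= rho^t].

    For the lower bound, the mass missing from [P^t(x, .)] near [theta*] is
    tested against a bump. If [x = theta*], then
    [P^t(x, .) = (1 - rho^t) Pi + rho^t delta_x] and a fixed bump away from [x]
    suffices. If [x <> theta*], on a set where [q/pi <= eps + u] and which
    avoids [x], the chain is rejected with probability at least [rho - u],
    while the error made by replacing [P^t(x, .)] by [Pi] in the accepted moves
    is [O(u rho^t)], by the upper bound already proved. Hence
    [P^t(x, .) <= (1 - rho^t (1 - 2 t u / rho)) Pi] on that set. By local
    Lipschitz continuity this applies to a ball of radius of order [u] around
    [theta*]; choosing [u] of order [1/t] yields
    [W >= K rho^t / t^(d+1)], and the polynomial factor disappears in the
    [t]-th root. *)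
Require Import Defs.
From HB Require Import structures.
From mathcomp Require Import all_boot all_order all_algebra.
From mathcomp Require Import all_classical all_reals all_analysis.
From mathcomp Require Import measurable_realfun ring lra.
Set Implicit Arguments.
Unset Strict Implicit.
Unset Printing Implicit Defensive.
Import Order.TTheory GRing.Theory Num.Theory.
Import numFieldNormedType.Exports.
Local Open Scope classical_set_scope.
Local Open Scope ring_scope.

(** * Kernels and couplings *)

(** Both integrals are integrals against the restrictions to [A], and restriction replaces [B] by a
    subset of [A]. This matters because upper bounds on the chain hold only on sets that avoid its
    starting point. *)
Lemma ge0_le_measure_integral_on d (X : measurableType d) (R : realType)
    (m1 m2 : {measure set X -> \bar R}) (A : set X) (f : X -> \bar R) :
  measurable A -> (forall B, measurable B -> B `<=` A -> (m1 B <= m2 B)%E) ->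
  (forall x, 0 <= f x)%E -> measurable_fun setT f ->
  (\int[m1]_(x in A) f x <= \int[m2]_(x in A) f x)%E.
Proof.
move=> mA m12 f0 mf.
have restrE (m : {measure set X -> \bar R}) :
    (\int[m]_(x in A) f x = \int[mrestr m mA]_(x in A) f x)%E.
  by apply: eq_measure_integral => B mB BA; rewrite -[in LHS](setIidl BA).
rewrite (restrE m1) (restrE m2); apply: ge0_le_measure_integral => // B mB.
by apply: m12; [exact: measurableI|exact: subIsetr].
Qed.

Section kernel_power_theory.
Local Open Scope ereal_scope.
Context d (X : measurableType d) (R : realType).

Lemma integral_mkcomp_noparam (k1 k2 : R.-pker X ~> X) x (f : X -> \bar R) :
  (forall z, 0 <= f z) -> measurable_fun setT f ->
  \int[mkcomp_noparam k1 k2 x]_z f z = \int[k1 x]_y \int[k2 y]_z f z.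
Proof.
move=> f0 mf; rewrite -[RHS](@integral_kcomp _ _ _ _ _ _ R k1
  (kernel.kernel_snd (T0 := X) k2))//.
Qed.

(** [kernel_pow] splits off the first step, whereas the inductions below need the last one; this is
    associativity of kernel composition. *)
Lemma kernel_powSr (P : R.-pker X ~> X) t x A : measurable A ->
  kernel_pow P t.+1 x A = \int[kernel_pow P t x]_y P y A.
Proof.
move=> mA; elim: t x => [|t IH] x.
  rewrite /= /kdirac integral_dirac// ?diracT ?mul1e//.
  exact: measurable_kernel.
have -> : kernel_pow P t.+2 x A = \int[P x]_y kernel_pow P t.+1 y A by [].
under eq_integral do rewrite IH.
(* The power 1 has its own clause in [kernel_pow], so the power unfolds to a composition only from 2
   on. *)
case: t IH => [|t] IH; first by apply: eq_integral => y _; rewrite -IH.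
by rewrite -integral_mkcomp_noparam//; exact: measurable_kernel.
Qed.

End kernel_power_theory.

(** * Upper and lower bounds on the Wasserstein distance *)

Section wasserstein_bounds.
Local Open Scope ereal_scope.
Context d (X : measurableType d) (R : realType).

Section residual.
Variables (mu : {measure set X -> \bar R}).
Variables (nu : {finite_measure set X -> \bar R}) (k : R).
Hypothesis knu : forall A, measurable A -> k%:E * nu A <= mu A.

(* A measure must be nonnegative on all sets, including nonmeasurable ones. *)
Definition residual of (forall A, measurable A -> k%:E * nu A <= mu A) :=
  fun A : set X => `|mu A - k%:E * nu A|.

Local Notation res := (residual knu).

Lemma residualE A : measurable A -> res A = mu A - k%:E * nu A.
Proof.
move=> mA; rewrite /residual gee0_abs//.
by rewrite sube_ge0 ?fin_numM ?fin_num_measure// knu.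
Qed.

Let res0 : res set0 = 0.
Proof. by rewrite residualE// !measure0 mule0 sube0. Qed.

Let res_ge0 A : 0 <= res A.
Proof. exact: abse_ge0. Qed.

Let res_sigma_additive : semi_sigma_additive res.
Proof.
move=> F mF tF mUF; rewrite residualE//.
rewrite (_ : (fun n => _) = (fun n =>
    \sum_(0 <= i < n) mu (F i) - k%:E * \sum_(0 <= i < n) nu (F i))); last first.
  apply/funext => n.
  under eq_bigr do rewrite residualE//.
  rewrite ge0_sume_distrr// -fin_num_sumeN ?big_split//.
  by move=> i _; rewrite fin_numM// fin_num_measure.
apply: cvgeB.
- by rewrite fin_num_adde_defl// fin_numN fin_numM// fin_num_measure.
- exact: measure_semi_sigma_additive.
- by apply: cvgeZl => //; exact: measure_semi_sigma_additive.
Qed.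

HB.instance Definition _ := isMeasure.Build _ _ _ res
  res0 res_ge0 res_sigma_additive.

End residual.

Definition diag_pair (x : X) := (x, x).

Let measurable_diag_pair : measurable_fun setT diag_pair.
Proof. by apply/measurable_fun_pairP; split; exact: measurable_id. Qed.

HB.instance Definition _ :=
  isMeasurableFun.Build _ _ _ _ diag_pair measurable_diag_pair.

(** The coupling is [(1 - c) nu] on the diagonal plus the product of the residual [mu - (1 - c) nu]
    with [nu]. The residual has mass [c], so the second marginal is [(1 - c) nu + c nu]; nothing is
    divided by [c], and [c = 0] needs no separate case. Only the product part costs anything, at
    most its mass [c]. *)
Lemma wasserstein_le (mu : {measure set X -> \bar R}) (nu : probability X R)
    (rho : X -> X -> R) (c : R) :
  mu setT = 1 -> (0 <= c <= 1)%R ->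
  measurable_fun setT (fun z : X * X => rho z.1 z.2) ->
  (forall x y, 0 <= rho x y <= 1)%R -> (forall x, rho x x = 0%R) ->
  (forall A, measurable A -> (1 - c)%:E * nu A <= mu A) ->
  wasserstein rho mu nu <= c%:E.
Proof.
move=> mu1 /andP[c0 c1] mrho rho01 rhoxx numu.
have k0 : (0 <= 1 - c)%R by rewrite subr_ge0.
pose M : {measure set X -> \bar R} := residual numu.
have ME A : measurable A -> M A = mu A - (1 - c)%:E * nu A. by exact: residualE.
have MT : M setT = c%:E.
  by rewrite ME// mu1 probability_setT mule1 -EFinB subKr.
pose D : {measure set (X * X) -> \bar R} := distribution nu diag_pair.
pose MN : {measure set (X * X) -> \bar R} := M \x nu.
pose xi : {measure set (X * X) -> \bar R} :=
  measure_add (mscale (NngNum k0) D) MN.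
have xiE A B : measurable A -> measurable B ->
    xi (A `*` B) = (1 - c)%:E * nu (A `&` B) + M A * nu B.
  move=> mA mB; rewrite [LHS]measure_addE; congr (_ + _).
  by rewrite [LHS]product_measure1E.
have xi1 : xi setT = 1.
  by rewrite -setXTT xiE// setIT probability_setT !mule1 MT -EFinD subrK.
pose xiP : probability (X * X)%type R :=
  HB.pack_for (probability (X * X)%type R) (xi : set (X * X) -> \bar R) xi
  (Measure_isProbability.Build _ _ _ xi xi1).
apply: (@le_trans _ _ (\int[xiP]_z (rho z.1 z.2)%:E)).
  apply: ereal_inf_lbound; exists xiP => //; split => A mA.
  - rewrite [LHS]xiE// setIT probability_setT mule1 ME// addeC subeK//.
    by rewrite fin_numM// fin_num_measure.
  - rewrite [LHS]xiE// setTI MT -ge0_muleDl ?lee_fin//.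
    by rewrite -EFinD subrK mul1e.
have mrhoE : measurable_fun setT (fun z : X * X => (rho z.1 z.2)%:E).
  exact/measurable_EFinP.
have rho0 z : 0 <= (rho z.1 z.2)%:E.
  by rewrite lee_fin; case/andP: (rho01 z.1 z.2).
rewrite [leLHS]ge0_integral_measure_add// ge0_integral_mscale//.
rewrite [X in _ * X + _](_ : _ = 0); last first.
  rewrite [LHS]ge0_integral_pushforward//=.
  by apply: integral0_eq => x _ /=; rewrite rhoxx.
rewrite mule0 add0e (@le_trans _ _ (\int[MN]__ 1))//.
  apply: ge0_le_integral => // z _; rewrite lee_fin.
  by case/andP: (rho01 z.1 z.2).
have MN1 : MN (setT `*` setT) = c%:E.
  transitivity (M setT * nu setT); first exact: product_measure1E.
  by rewrite MT probability_setT mule1.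
by rewrite integral_cst// mul1e -setXTT MN1.
Qed.

(* Easy half of Kantorovich duality, for nonnegative test functions. *)
Lemma wasserstein_ge (mu nu : {measure set X -> \bar R}) (rho : X -> X -> R)
    (phi : X -> R) :
  measurable_fun setT (fun z : X * X => rho z.1 z.2) ->
  (forall x y, 0 <= rho x y)%R ->
  measurable_fun setT phi -> (forall x, 0 <= phi x)%R ->
  (forall x y, phi y - phi x <= rho x y)%R ->
  \int[mu]_x (phi x)%:E < +oo ->
  \int[nu]_x (phi x)%:E - \int[mu]_x (phi x)%:E <= wasserstein rho mu nu.
Proof.
move=> mrho rho0 mphi phi0 phirho foo.
apply: le_ereal_inf_tmp => _ /= [xi [xi1 xi2] <-].
have mphiE : measurable_fun setT (EFin \o phi) by exact/measurable_EFinP.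
have phiE0 x : 0 <= (phi x)%:E by rewrite lee_fin.
have mrhoE : measurable_fun setT (fun z : X * X => (rho z.1 z.2)%:E).
  exact/measurable_EFinP.
have e1 : \int[mu]_x (phi x)%:E = \int[xi]_z (phi z.1)%:E.
  rewrite -(@ge0_integral_pushforward _ _ _ _ _ fst _ xi setT
    (EFin \o phi))//; first last.
    by move=> y _; exact: phiE0.
  apply: eq_measure_integral => A mA _; rewrite -xi1//; congr (xi _).
  by apply/seteqP; split=> [[x y] []|[x y] ?].
have e2 : \int[nu]_x (phi x)%:E = \int[xi]_z (phi z.2)%:E.
  rewrite -(@ge0_integral_pushforward _ _ _ _ _ snd _ xi setT
    (EFin \o phi))//; first last.
    by move=> y _; exact: phiE0.
  apply: eq_measure_integral => A mA _; rewrite -xi2//; congr (xi _).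
  by apply/seteqP; split=> [[x y] []|[x y] ?].
rewrite leeBlDr; last by rewrite ge0_fin_numE// integral_ge0.
rewrite e1 e2 -ge0_integralD//.
- apply: ge0_le_integral => //.
  - exact: (measurableT_comp mphiE).
  - by apply: emeasurable_funD => //; exact: (measurableT_comp mphiE).
  - by move=> z _; rewrite -EFinD lee_fin -lerBlDr.
- by move=> z _; rewrite lee_fin.
- exact: (measurableT_comp mphiE).
Qed.

End wasserstein_bounds.

(** * The Metropolis-Hastings independence kernel *)

(** By uniqueness, [f] agrees almost everywhere with the Radon-Nikodym derivative, for which the
    change of variables is known. *)
Lemma integral_density d (X : measurableType d) (R : realType)
    (mu : {sigma_finite_measure set X -> \bar R}) (P : probability X R)
    (f : X -> R) (g : X -> \bar R) :
  measurable_fun setT f -> (forall x, 0 <= f x) ->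
  (forall A, measurable A -> P A = (\int[mu]_(x in A) (f x)%:E)%E) ->
  P.-integrable setT g ->
  (\int[P]_x g x = \int[mu]_x (g x * (f x)%:E))%E.
Proof.
move=> mf f0 PE ig.
have mfE : measurable_fun setT (EFin \o f) by exact/measurable_EFinP.
have if_ : mu.-integrable setT (EFin \o f).
  apply/integrableP; split => //.
  under eq_integral do rewrite /= ger0_norm//.
  by rewrite -PE// probability_setT ltry.
have Pmu : P `<< mu.
  apply/null_content_dominatesP => A mA muA.
  rewrite PE//; apply: null_set_integral => //; exact: measurable_funTS.
rewrite -(@Radon_Nikodym_change_of_variables _ _ _ P mu Pmu)//.
apply: ae_eq_integral => //.
- by apply: emeasurable_funM => //; exact: measurable_int ig.
- by apply: emeasurable_funM => //; exact: measurable_int ig.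
apply: ae_eqe_mul2l; apply: integral_ae_eq => //.
  exact: Radon_Nikodym_integrable.
by move=> E _ mE; rewrite -Radon_Nikodym_integral//= -PE.
Qed.

Section mhi_theory.
Context (R : realType) (d : nat).
Local Notation T := 'rV[R]_d.
Local Notation leb := (lebesgue_rV R d).
Variables (Pi Q : probability T R) (pi q : T -> R).
Hypotheses (hpi : has_density Pi pi) (hq : has_density Q q).
Local Open Scope ereal_scope.

Local Notation aq x y := (mhi_accept pi q x y * q y)%R.

Let mpi : measurable_fun setT pi. Proof. by case: hpi. Qed.
Let pi_ge0 x : (0 <= pi x)%R. Proof. by case: hpi. Qed.
Let mq : measurable_fun setT q. Proof. by case: hq. Qed.
Let q_ge0 x : (0 <= q x)%R. Proof. by case: hq. Qed.

Lemma mhi_accept_ge0 x y : (0 <= mhi_accept pi q x y)%R.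
Proof.
rewrite /mhi_accept; case: ifP => // _.
by rewrite le_min ler01 andbT divr_ge0// mulr_ge0.
Qed.

Lemma mhi_accept_le1 x y : (mhi_accept pi q x y <= 1)%R.
Proof. by rewrite /mhi_accept; case: ifP => // _; rewrite ge_min lexx orbT. Qed.

Lemma aq_ge0 x y : (0 <= aq x y)%R.
Proof. by rewrite mulr_ge0// mhi_accept_ge0. Qed.

Lemma aq_le x y : (aq x y <= q y)%R.
Proof. by rewrite ler_piMl// mhi_accept_le1. Qed.

(** The right-hand side is symmetric in [x] and [y], which is detailed balance. In the default
    branch of the acceptance probability, [pi x * q y = 0] and both sides vanish. *)
Lemma pi_aqE x y : (pi x * aq x y = Num.min (pi y * q x) (pi x * q y))%R.
Proof.
rewrite /mhi_accept; case: ifPn => [h|].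
  by rewrite mulrCA minr_pMl ?ltW// mul1r divfK ?gt_eqF.
rewrite -leNgt => h; rewrite mul1r.
have -> : (pi x * q y = 0)%R by apply/eqP; rewrite eq_le h mulr_ge0.
by apply/esym/min_idPr; rewrite mulr_ge0.
Qed.

Lemma detailed_balance x y : (pi x * aq x y = pi y * aq y x)%R.
Proof. by rewrite !pi_aqE minC. Qed.

Lemma measurable_aq : measurable_fun setT (fun z : T * T => aq z.1 z.2).
Proof.
have mpi1 : measurable_fun setT (fun z : T * T => pi z.1).
  exact: (measurableT_comp mpi).
have mpi2 : measurable_fun setT (fun z : T * T => pi z.2).
  exact: (measurableT_comp mpi).
have mq1 : measurable_fun setT (fun z : T * T => q z.1).
  exact: (measurableT_comp mq).
have mq2 : measurable_fun setT (fun z : T * T => q z.2).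
  exact: (measurableT_comp mq).
have mden : measurable_fun setT (fun z : T * T => pi z.1 * q z.2)%R.
  exact: measurable_funM.
apply: measurable_funM => //; apply: measurable_fun_ifT => //.
  exact: measurable_fun_ltr.
apply: measurable_minr => //; apply: measurable_funM.
  exact: measurable_funM.
(* The inverse is treated as the power -1, whose measurability is [measurable_powR]. *)
under eq_fun do rewrite -powR_inv1 ?mulr_ge0//.
exact: (measurableT_comp (measurable_powR _) mden).
Qed.

Let maq x : measurable_fun setT (fun y => (aq x y)%:E).
Proof.
apply/measurable_EFinP.
exact: (measurableT_comp measurable_aq (measurable_pair1 x)).
Qed.

(** The probability of an accepted move into [A]; [1 - mhi_move setT x] is then the rejection
    probability at [x]. *)
Definition mhi_move (A : set T) (x : T) := \int[leb]_(y in A) (aq x y)%:E.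

Lemma mhi_move_ge0 A x : 0 <= mhi_move A x.
Proof. by apply: integral_ge0 => y _; rewrite lee_fin aq_ge0. Qed.

Lemma mhi_move_le A x : measurable A -> mhi_move A x <= Q A.
Proof.
move=> mA; case: hq => _ _ ->//; apply: ge0_le_integral => //.
- by move=> y _; rewrite lee_fin aq_ge0.
- exact: measurable_funTS.
- by apply/measurable_EFinP; exact: measurable_funTS.
- by move=> y _; rewrite lee_fin aq_le.
Qed.

Lemma mhi_move_fin A x : measurable A -> mhi_move A x \is a fin_num.
Proof.
move=> mA; rewrite ge0_fin_numE ?mhi_move_ge0//.
apply: le_lt_trans (mhi_move_le x mA) _.
by rewrite ltey_eq fin_num_measure.
Qed.

Lemma measurable_mhi_move A : measurable A -> measurable_fun setT (mhi_move A).
Proof.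
move=> mA; rewrite /mhi_move.
under eq_fun do rewrite integral_mkcond.
have := @measurable_fun_fubini_tonelli_F _ _ T T R leb
  (fun z => ((fun y => (aq z.1 y)%:E) \_ A) z.2).
apply; last first.
  by move=> z; rewrite patchE; case: ifPn => // _; rewrite lee_fin aq_ge0.
rewrite (_ : (fun z => _) =
   (fun z : T * T => (aq z.1 z.2)%:E * (\1_A z.2)%:E)); last first.
  apply/funext => z; rewrite patchE indicE.
  by case: ifPn => _; rewrite ?mule1 ?mule0.
apply: emeasurable_funM; first by apply/measurable_EFinP; exact: measurable_aq.
apply/measurable_EFinP.
exact: (measurableT_comp (measurable_indic (R := R) mA) measurable_snd).
Qed.

Lemma mhiE x A : mhi hpi hq x A = mhi_move A x + \d_x A * (1 - mhi_move setT x).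
Proof. by []. Qed.

Lemma mhi_move_le1 x : mhi_move setT x <= 1.
Proof. by rewrite -(@probability_setT _ _ _ Q) mhi_move_le. Qed.

Lemma mhi_reject_ge0 x : 0 <= 1 - mhi_move setT x.
Proof. by rewrite sube_ge0 ?mhi_move_le1// orbT. Qed.

Lemma measurable_mhi_reject : measurable_fun setT (fun x => 1 - mhi_move setT x).
Proof. by apply: emeasurable_funB => //; exact: measurable_mhi_move. Qed.

Lemma integral_mhi (mu : {measure set T -> \bar R}) A : measurable A ->
  \int[mu]_x mhi hpi hq x A =
  \int[mu]_x mhi_move A x + \int[mu]_(x in A) (1 - mhi_move setT x).
Proof.
move=> mA; under eq_integral do rewrite mhiE.
rewrite ge0_integralD//.
- congr (_ + _); rewrite [RHS]integral_mkcond; apply: eq_integral => x _.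
  rewrite patchE diracE; case: ifPn => _; by rewrite ?mul1e ?mul0e.
- by move=> x _; exact: mhi_move_ge0.
- exact: measurable_mhi_move.
- by move=> x _; rewrite mule_ge0// mhi_reject_ge0.
- apply: emeasurable_funM; last exact: measurable_mhi_reject.
  exact: measurable_fun_dirac.
Qed.

(** By reversibility, the [Pi]-mass moved into [A] equals the mass moved out of points of [A];
    adding the mass rejected in [A] restores [Pi A]. *)
Lemma mhi_invariant A : measurable A -> \int[Pi]_x mhi hpi hq x A = Pi A.
Proof.
move=> mA; have [_ _ PiE] := hpi.
have mP : measurable_fun setT (fun x => mhi hpi hq x A).
  exact: measurable_kernel.
have iP : Pi.-integrable setT (fun x => mhi hpi hq x A).
  apply: (@le_integrable _ _ _ Pi setT _ _ (EFin \o cst 1%R)) => //.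
    move=> x _ /=; rewrite gee0_abs// normr1.
    have <- : mhi hpi hq x setT = 1 by exact: prob_kernel.
    by rewrite le_measure// inE.
  exact: finite_measure_integrable_cst.
rewrite (integral_density mpi pi_ge0 PiE iP).
under eq_integral.
  move=> x _; rewrite mhiE ge0_muleDl ?mhi_move_ge0 ?mule_ge0 ?mhi_reject_ge0//.
  over.
have mpiE : measurable_fun setT (fun x => (pi x)%:E) by exact/measurable_EFinP.
rewrite ge0_integralD//; last 4 first.
- by move=> x _; rewrite mule_ge0 ?mhi_move_ge0 ?lee_fin.
- by apply: emeasurable_funM => //; exact: measurable_mhi_move.
- by move=> x _; rewrite !mule_ge0 ?mhi_reject_ge0 ?lee_fin.
- apply: emeasurable_funM => //; apply: emeasurable_funM.
    exact: measurable_fun_dirac.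
  exact: measurable_mhi_reject.
(* Tonelli exchanges departure and arrival points, then detailed balance reverses the direction of
   the move. *)
have -> : \int[leb]_x (mhi_move A x * (pi x)%:E) =
    \int[leb]_(y in A) (mhi_move setT y * (pi y)%:E).
  transitivity (\int[leb]_x \int[leb]_y ((pi x * aq x y) * \1_A y)%:E).
    apply: eq_integral => x _; rewrite /mhi_move integral_mkcond muleC.
    rewrite -ge0_integralZl//; last 3 first.
    - exact/(measurable_restrictT _ _).1/measurable_funTS.
    - by move=> y _; rewrite patchE; case: ifPn => // _; rewrite lee_fin aq_ge0.
    - by rewrite lee_fin.
    apply: eq_integral => y _; rewrite patchE indicE.
    by case: ifPn => _; rewrite ?mule0 ?mulr0 ?mulr1 ?EFinM.
  rewrite (@fubini_tonelli _ _ T T R leb leb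
    (fun z => (pi z.1 * aq z.1 z.2 * \1_A z.2)%:E)); last 2 first.
  - apply/measurable_EFinP; apply: measurable_funM.
      apply: measurable_funM; last exact: measurable_aq.
      exact: (measurableT_comp mpi).
    exact: (measurableT_comp (measurable_indic (R := R) mA) measurable_snd).
  - by move=> z; rewrite lee_fin !mulr_ge0 ?mhi_accept_ge0.
  rewrite [RHS]integral_mkcond; apply: eq_integral => y _ /=.
  rewrite patchE indicE; case: ifPn => _; last first.
    by rewrite integral0_eq// => x _; rewrite mulr0.
  rewrite muleC -ge0_integralZl//; last first.
  - by rewrite lee_fin.
  - by move=> x _; rewrite lee_fin aq_ge0.
  by apply: eq_integral => x _; rewrite mulr1 detailed_balance.
have -> : \int[leb]_x (\d_x A * (1 - mhi_move setT x) * (pi x)%:E) =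
    \int[leb]_(x in A) ((1 - mhi_move setT x) * (pi x)%:E).
  rewrite [RHS]integral_mkcond; apply: eq_integral => x _.
  by rewrite patchE diracE; case: ifPn => _; rewrite ?mul1e ?mul0e.
rewrite -ge0_integralD//; last 4 first.
- by move=> x _; rewrite mule_ge0 ?mhi_move_ge0 ?lee_fin.
- apply: measurable_funTS; apply: emeasurable_funM => //.
  exact: measurable_mhi_move.
- by move=> x _; rewrite !mule_ge0 ?mhi_reject_ge0 ?lee_fin.
- apply: measurable_funTS; apply: emeasurable_funM => //.
  exact: measurable_mhi_reject.
rewrite PiE//; apply: eq_integral => x _.
rewrite -ge0_muleDl ?mhi_move_ge0 ?mhi_reject_ge0//.
by rewrite addeC subeK ?mul1e ?mhi_move_fin.
Qed.

Let mpiE : measurable_fun setT (fun x => (pi x)%:E).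
Proof. exact/measurable_EFinP. Qed.

Let mqE : measurable_fun setT (fun x => (q x)%:E).
Proof. exact/measurable_EFinP. Qed.

Let PiE A : measurable A -> Pi A = \int[leb]_(x in A) (pi x)%:E.
Proof. by case: hpi => _ _; exact. Qed.

Let QE A : measurable A -> Q A = \int[leb]_(x in A) (q x)%:E.
Proof. by case: hq => _ _; exact. Qed.

Let PiZ (c : R) A : (0 <= c)%R -> measurable A ->
  c%:E * Pi A = \int[leb]_(x in A) (c * pi x)%:E.
Proof.
move=> c0 mA; rewrite PiE// -ge0_integralZl//.
- exact: measurable_funTS.
- by move=> y _; rewrite lee_fin.
Qed.

(** This keeps the first term of the minimum in [pi_aqE]. At a minimizer of [q / pi] it meets the
    lower bound [aq_minor]. *)
Lemma aq_le_ratio x y : (0 < pi x)%R -> (aq x y <= q x / pi x * pi y)%R.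
Proof.
move=> pix; rewrite -(ler_pM2l pix) pi_aqE.
by rewrite mulrA mulrCA mulfV ?gt_eqF// mulr1 ge_min mulrC lexx.
Qed.

Lemma mhi_move_le_ratio A x : measurable A -> (0 < pi x)%R ->
  mhi_move A x <= (q x / pi x)%:E * Pi A.
Proof.
move=> mA pix; rewrite PiZ ?divr_ge0//; apply: ge0_le_integral => //.
- by move=> y _; rewrite lee_fin aq_ge0.
- exact: measurable_funTS.
- by apply: measurable_funTS; apply/measurable_EFinP; exact: measurable_funM.
- by move=> y _; rewrite lee_fin aq_le_ratio.
Qed.

(** * Powers of the kernel under the minorization [eps * pi <= q] *)

Section minorization.
Variable eps : R.
Hypothesis eps0 : (0 <= eps)%R.
Hypothesis epsq : forall y, (eps * pi y <= q y)%R.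

(** Both terms of the minimum in [pi_aqE] are at least [eps * pi x * pi y]. Where [pi x = 0] every
    proposal is accepted and the bound is [epsq]. *)
Lemma aq_minor x y : (eps * pi y <= aq x y)%R.
Proof.
have [pix0|pix] := eqVneq (pi x) 0%R.
  by rewrite /mhi_accept pix0 mul0r ltxx mul1r.
have {}pix : (0 < pi x)%R by rewrite lt0r pix/=.
rewrite -(ler_pM2l pix) pi_aqE le_min; apply/andP; split.
  by rewrite mulrA [leLHS]mulrC ler_wpM2l// mulrC.
by rewrite ler_wpM2l.
Qed.

Lemma mhi_move_minor A x : measurable A -> eps%:E * Pi A <= mhi_move A x.
Proof.
move=> mA; rewrite PiZ//; apply: ge0_le_integral => //.
- by move=> y _; rewrite lee_fin mulr_ge0.
- by apply: measurable_funTS; apply/measurable_EFinP; exact: measurable_funM.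
- exact/measurable_funTS.
- by move=> y _; rewrite lee_fin aq_minor.
Qed.

Lemma mhi_minor A x : measurable A -> eps%:E * Pi A <= mhi hpi hq x A.
Proof.
move=> mA; rewrite mhiE (le_trans (mhi_move_minor x mA))// leeDl//.
by rewrite mule_ge0// mhi_reject_ge0.
Qed.

(** Where [q / pi] is within [u] of [eps], the accepted density [eps * pi] falls short of [q] by at
    most [u * pi]: almost every proposal into [A] is accepted. *)
Lemma mhi_move_ge (u : R) A x : (0 <= u)%R -> measurable A ->
  (forall y, A y -> q y <= (eps + u) * pi y)%R ->
  Q A <= mhi_move A x + u%:E * Pi A.
Proof.
move=> u0 mA Au; rewrite PiZ// QE// -ge0_integralD//; last 4 first.
- by move=> y _; rewrite lee_fin aq_ge0.
- exact: measurable_funTS.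
- by move=> y _; rewrite lee_fin mulr_ge0.
- by apply: measurable_funTS; apply/measurable_EFinP; exact: measurable_funM.
apply: ge0_le_integral => //.
- by move=> y _; rewrite lee_fin.
- exact: measurable_funTS.
- apply: measurable_funTS; apply: emeasurable_funD => //.
  by apply/measurable_EFinP; exact: measurable_funM.
- move=> y /Au; rewrite mulrDl -EFinD lee_fin => /le_trans; apply.
  by rewrite lerD2r aq_minor.
Qed.

Lemma mhi_reject_ge (u : R) x : (0 < pi x)%R -> (q x <= (eps + u) * pi x)%R ->
  (1 - eps - u)%:E <= 1 - mhi_move setT x.
Proof.
move=> pix qx; rewrite -addrA -opprD EFinB leeB//.
rewrite (le_trans (mhi_move_le_ratio measurableT pix))//.
by rewrite probability_setT mule1 lee_fin ler_pdivrMr.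
Qed.

(** At a minimizer the upper bound [aq_le_ratio] and the lower bound [aq_minor] coincide, so the
    accepted part is exactly [eps * Pi]. *)
Lemma mhi_at_min x A : (0 < pi x)%R -> q x = (eps * pi x)%R -> measurable A ->
  mhi hpi hq x A = eps%:E * Pi A + (1 - eps)%:E * \d_x A.
Proof.
move=> pix qx mA; have moveE B : measurable B -> mhi_move B x = eps%:E * Pi B.
  move=> mB; apply/eqP; rewrite eq_le mhi_move_minor// andbT.
  by rewrite (le_trans (mhi_move_le_ratio mB pix))// qx mulfK ?gt_eqF.
by rewrite mhiE !moveE// probability_setT mule1 [X in _ + X]muleC.
Qed.

Let mP A : measurable A -> measurable_fun setT (fun x => mhi hpi hq x A).
Proof. exact: measurable_kernel. Qed.

(** The induction hypothesis is applied not to the kernel but to [g], what remains after removing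
    [eps * Pi A]. Invariance gives [g] the [Pi]-integral [(1 - eps) * Pi A], and [(1 - r) * (1 -
    eps) + eps = 1 - r * (1 - eps)]. *)
Lemma mhi_pow_minor t x A : (eps <= 1)%R -> measurable A ->
  (1 - (1 - eps) ^+ t)%:E * Pi A <= kernel_pow (mhi hpi hq) t x A.
Proof.
move=> eps1; elim: t A => [|t IH] A mA.
  by rewrite expr0 subrr mul0e.
set c := (1 - (1 - eps) ^+ t)%R in IH.
have c0 : (0 <= c)%R by rewrite subr_ge0 exprn_ile1 ?subr_ge0// gerBl.
pose mu := kernel_pow (mhi hpi hq) t x.
have PiA : Pi A \is a fin_num by rewrite fin_num_measure.
have ePiA : eps%:E * Pi A \is a fin_num by rewrite fin_numM.
pose g z := mhi hpi hq z A - eps%:E * Pi A.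
have g0 z : 0 <= g z by rewrite sube_ge0 ?ePiA// mhi_minor.
have mg : measurable_fun setT g by apply: emeasurable_funB => //; exact: mP.
have Pg (m : {measure set T -> \bar R}) : m setT = 1 ->
    \int[m]_z mhi hpi hq z A = \int[m]_z g z + eps%:E * Pi A.
  move=> m1; rewrite -[X in _ + X]mule1 -m1 -integral_cst//.
  rewrite -ge0_integralD//; last by move=> z _; rewrite mule_ge0.
  by apply: eq_integral => z _; rewrite subeK.
rewrite kernel_powSr// Pg; last exact: prob_kernel.
have := Pg Pi (probability_setT Pi); rewrite mhi_invariant//.
have : c%:E * \int[Pi]_z g z <= \int[mu]_z g z.
  rewrite -[leLHS](ge0_integral_mscale Pi measurableT (NngNum c0))//.
  by apply: ge0_le_measure_integral => // B mB; exact: IH.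
rewrite -/mu => gPimu PiAg.
have ig : \int[Pi]_z g z \is a fin_num.
  by move: PiA; rewrite PiAg fin_numD => /andP[].
move: gPimu PiAg; rewrite -(fineK ig) -(fineK PiA) -!EFinM -EFinD => gPimu [h].
move: gPimu.
move: (\int[mu]_z g z) => [y| |] //; rewrite ?leey//.
rewrite -EFinD !lee_fin exprS; move: h; rewrite /c.
set p := fine _; set w := fine _; set r := (_ ^+ t)%R.
move=> h; have -> : w = (p - eps * p)%R by lra.
by move=> h2; lra.
Qed.

Lemma mhi_pow_at_min t x A : (eps <= 1)%R -> (0 < pi x)%R ->
  q x = (eps * pi x)%R -> measurable A ->
  kernel_pow (mhi hpi hq) t x A =
  (1 - (1 - eps) ^+ t)%:E * Pi A + ((1 - eps) ^+ t)%:E * \d_x A.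
Proof.
move=> eps1 pix qx; elim: t A => [|t IH] A mA.
  by rewrite expr0 subrr mul0e add0e mul1e.
rewrite kernel_powSr//.
have r0 : (0 <= (1 - eps) ^+ t)%R by rewrite exprn_ge0// subr_ge0.
have c0 : (0 <= 1 - (1 - eps) ^+ t)%R.
  by rewrite subr_ge0 exprn_ile1 ?subr_ge0// gerBl.
rewrite (eq_measure_integral (measure_add (mscale (NngNum c0) Pi)
  (mscale (NngNum r0) \d_x))); last first.
  by move=> B mB _; rewrite IH//; apply/esym; exact: measure_addE.
rewrite ge0_integral_measure_add//; last exact: mP.
rewrite !ge0_integral_mscale//; [|exact: mP|exact: mP].
rewrite mhi_invariant// integral_dirac//; last exact: mP.
rewrite diracT mul1e (mhi_at_min pix qx mA) /=.
have PiA : Pi A \is a fin_num by rewrite fin_num_measure.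

rewrite -(fineK PiA) diracE !(=^~ EFinM, =^~ EFinD) exprS.
by congr EFin; ring.
Qed.

(** Here [del] is the relative deficit of [mu] on [A] before the step. Accepted moves into [A]
    exceed their value under [Pi] by at most [r * u * Pi A], since [mu] dominates [(1 - r) * Pi].
    Rejected moves retain the deficit with probability at least [1 - eps - u]. Under [Pi] the two
    parts sum to [Pi A]. *)
Lemma mhi_step_le (mu : {measure set T -> \bar R}) (r del u : R) A :
  mu setT = 1 -> (0 <= r <= 1)%R -> (0 <= del <= 1)%R -> (0 <= u)%R ->
  measurable A -> (forall y, A y -> 0 < pi y)%R ->
  (forall y, A y -> q y <= (eps + u) * pi y)%R ->
  (forall B, measurable B -> (1 - r)%:E * Pi B <= mu B) ->
  (forall B, measurable B -> B `<=` A -> mu B <= (1 - del)%:E * Pi B) ->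
  \int[mu]_x mhi hpi hq x A <= (1 + r * u - del * (1 - eps - u))%:E * Pi A.
Proof.
move=> muT /andP[r0 r1] /andP[del0 del1] u0 mA Api Aq Pimu muPi.
have PiA : Pi A \is a fin_num by rewrite fin_num_measure.
have QA : Q A \is a fin_num by rewrite fin_num_measure.
have mmove : measurable_fun setT (mhi_move A) by exact: measurable_mhi_move.
have mrej := measurable_mhi_reject.
have kr : (0 <= 1 - r)%R by rewrite subr_ge0.
have kd : (0 <= 1 - del)%R by rewrite subr_ge0.
(* Complement of the move probability: unlike [mhi_move A] itself it is of
   order [u], which is what makes the error term small. *)
pose L z := Q A - mhi_move A z.
have L0 z : 0 <= L z by rewrite sube_ge0 ?QA ?orbT// mhi_move_le.
have mL : measurable_fun setT L by apply: emeasurable_funB.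
have QL (m : {measure set T -> \bar R}) : m setT = 1 ->
    Q A = \int[m]_z L z + \int[m]_z mhi_move A z.
  move=> m1; rewrite -ge0_integralD//; last by move=> z _; exact: mhi_move_ge0.
  under eq_integral do rewrite subeK ?mhi_move_fin//.
  by rewrite integral_cst// m1 mule1.
have PiL : \int[Pi]_z L z <= u%:E * Pi A.
  apply: (@le_trans _ _ (\int[Pi]__ (u%:E * Pi A))).
    apply: ge0_le_integral => // z _.
    by rewrite leeBlDl ?mhi_move_fin// mhi_move_ge.
  rewrite integral_cst// [X in _ * X](_ : _ = 1) ?mule1//.
  exact: probability_setT.
have muL : (1 - r)%:E * \int[Pi]_z L z <= \int[mu]_z L z.
  rewrite -[leLHS](ge0_integral_mscale Pi measurableT (NngNum kr))//.
  by apply: ge0_le_measure_integral => // B mB; exact: Pimu.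
have murej : \int[mu]_(x in A) (1 - mhi_move setT x) <=
    (1 - del)%:E * \int[Pi]_(x in A) (1 - mhi_move setT x).
  rewrite -[leRHS](ge0_integral_mscale Pi mA (NngNum kd))//; last 2 first.
    exact: measurable_funTS.
    by move=> x _; exact: mhi_reject_ge0.
  by apply: ge0_le_measure_integral_on => // x; exact: mhi_reject_ge0.
have Pirej : (1 - eps - u)%:E * Pi A <= \int[Pi]_(x in A) (1 - mhi_move setT x).
  (* When [1 - eps - u] is negative the bound is trivial. *)
  have [w0|/ltW w0] := leP 0%R (1 - eps - u)%R; last first.
    apply: (@le_trans _ _ 0); first by rewrite mule_le0_ge0.
    by apply: integral_ge0 => x _; exact: mhi_reject_ge0.
  rewrite -integral_cst//; apply: ge0_le_integral => //.
    exact: measurable_funTS.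
  by move=> x Ax; rewrite mhi_reject_ge ?Api ?Aq.
have rejPi0 : 0 <= \int[Pi]_(x in A) (1 - mhi_move setT x).
  by apply: integral_ge0 => x _; exact: mhi_reject_ge0.
have rejmu0 : 0 <= \int[mu]_(x in A) (1 - mhi_move setT x).
  by apply: integral_ge0 => x _; exact: mhi_reject_ge0.
have := mhi_invariant mA; have := QL _ muT; have := QL Pi (probability_setT Pi).
rewrite !integral_mhi//.
move: PiA QA PiL muL murej Pirej rejPi0 rejmu0.
move: (Pi A) (Q A) (\int[Pi]_x L x) (\int[mu]_x L x)
  (\int[Pi]_x mhi_move A x) (\int[mu]_x mhi_move A x)
  (\int[Pi]_(x in A) (1 - mhi_move setT x))
  (\int[mu]_(x in A) (1 - mhi_move setT x)).
move=> [p| |] // [Qa| |] // [l| |] // [l'| |] // [a| |] // [a'| |] // [b| |] //.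
move=> [b'| |] //.
rewrite -!EFinM -!EFinD ?lee_fin => _ _ lup ll' bb' bp b0 b0'.
move=> [Qla] [Qla'] [abp].
have rl : (r * l <= r * (u * p))%R by rewrite ler_wpM2l.
have delb : (del * ((1 - eps - u) * p) <= del * b)%R by rewrite ler_wpM2l.
by lra.
Qed.

(** By [mhi_step_le] each step multiplies the deficit by [1 - eps] up to a relative loss of at most
    [2 * u / (1 - eps)]: one [u] from imperfect acceptance, one from the rejection probability. The
    losses add up over [t] steps; the hypothesis on [t * u] keeps the deficit in [[0, 1]]. *)
Lemma mhi_pow_deficit (u : R) x A0 t : (eps < 1)%R -> (0 <= u)%R ->
  ~ A0 x -> (forall y, A0 y -> 0 < pi y)%R ->
  (forall y, A0 y -> q y <= (eps + u) * pi y)%R ->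
  ((t * 2)%:R * u <= 1 - eps)%R ->
  forall A, measurable A -> A `<=` A0 ->
  kernel_pow (mhi hpi hq) t x A <=
  (1 - (1 - eps) ^+ t * (1 - (t * 2)%:R * u / (1 - eps)))%:E * Pi A.
Proof.
move=> eps1 u0 A0x A0pi A0q; have rho0 : (0 < 1 - eps)%R by rewrite subr_gt0.
elim: t => [|t IH] tu A mA AA0.
  (* At time 0 the chain sits at [x], outside [A], so the deficit is complete. *)
  rewrite /= /kdirac diracE memNset ?mul0r ?subr0 ?expr0 ?mul1r ?subrr ?mul0e//.
  by move=> /AA0.
have tu' : ((t * 2)%:R * u <= 1 - eps)%R.
  by rewrite (le_trans _ tu)// ler_wpM2r// ler_nat leq_mul.
set r := ((1 - eps) ^+ t)%R in IH *.
set w := ((t * 2)%:R * u / (1 - eps))%R in IH *.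
have w0 : (0 <= w)%R by rewrite divr_ge0 ?mulr_ge0// ltW.
have w1 : (w <= 1)%R by rewrite ler_pdivrMr// mul1r.
have r0 : (0 <= r)%R by rewrite exprn_ge0// ltW.
have r1 : (r <= 1)%R by rewrite exprn_ile1 ?(ltW rho0)// gerBl.
rewrite kernel_powSr//.
have IHmu : forall B, measurable B -> B `<=` A ->
    kernel_pow (mhi hpi hq) t x B <= (1 - r * (1 - w))%:E * Pi B.
  by move=> B mB BA; apply: IH => //; exact: subset_trans AA0.
apply: (@le_trans _ _ _ _ _ (mhi_step_le (r := r) _ _ _ u0 mA _ _ _ IHmu)) => //.
- exact: prob_kernel.
- exact/andP.
- by rewrite mulr_ge0 ?subr_ge0//= mulr_ile1 ?subr_ge0// gerBl.
- by move=> y /AA0; exact: A0pi.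
- by move=> y /AA0; exact: A0q.
- by move=> B mB; exact: mhi_pow_minor (ltW eps1) mB.
apply: lee_wpmul2r => //; rewrite lee_fin exprS -/r.
set v := (u / (1 - eps))%R.
have uE : u = (v * (1 - eps))%R by rewrite /v divfK ?gt_eqF.
have v0 : (0 <= v)%R by rewrite divr_ge0// ltW.
have -> : ((t.+1 * 2)%:R * u / (1 - eps) = 2 * v + w)%R.
  by rewrite mulSn natrD /v /w; ring.
rewrite uE.
(* The second-order term [r * w * u], nonnegative and therefore dropped. *)
have h : (0 <= (r * w) * (v * (1 - eps)))%R.
  by apply: mulr_ge0; apply: mulr_ge0 => //; exact: ltW.
by lra.
Qed.

End minorization.
End mhi_theory.

(** * Norms and test functions *)

Lemma coord_le_norm (R : realType) (d : nat) (x : 'rV[R]_d) i :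
  `|x ord0 i| <= `|x|.
Proof.
have /mapP[j _ ->] : `|x ord0 i| \in [seq `|x k.1 k.2| | k : 'I_1 * 'I_d].
  by apply/mapP; exists (ord0, i) => //=; rewrite mem_enum.
rewrite [leRHS]/Num.norm /= mx_normrE; apply/bigmax_geP.
by right => /=; exists j.
Qed.

(** * Measurability of a norm and comparison with the sup norm *)

Section norm_theory.
Context (R : realType) (d : nat).
Local Notation T := 'rV[R]_d.
Variable N : T -> R.
Hypothesis hN : is_norm N.

Lemma is_normZ a x : N (a *: x) = `|a| * N x.
Proof. by case: hN. Qed.

Lemma is_normD x y : N (x + y) <= N x + N y.
Proof. by case: hN. Qed.

Lemma is_norm0 : N 0 = 0.
Proof. by rewrite -(scale0r 0) is_normZ normr0 mul0r. Qed.

Lemma is_normN x : N (- x) = N x.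
Proof. by rewrite -scaleN1r is_normZ normrN1 mul1r. Qed.

Lemma is_norm_ge0 x : 0 <= N x.
Proof.
have := is_normD x (- x).
by rewrite subrr is_norm0 is_normN -mulr2n pmulrn_lge0.
Qed.

Lemma is_norm_gt0 x : x != 0 -> 0 < N x.
Proof.
move=> x0; rewrite lt0r is_norm_ge0 andbT; apply: contra_neq x0.
by case: hN => + _ _; exact.
Qed.

Lemma is_normC x y : N (x - y) = N (y - x).
Proof. by rewrite -is_normN opprB. Qed.

Lemma is_norm_sub_le x y z : N (x - z) <= N (x - y) + N (y - z).
Proof. by rewrite -[x - z](subrKA y) is_normD. Qed.

(** A majorant of [N] built from the coordinates, hence measurable for the sigma-algebra they
    generate. *)
Let major (x : T) := \sum_(i < d) `|x ord0 i| * N (delta_mx ord0 i).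

Let norm_major x : N x <= major x.
Proof.
rewrite [x in leLHS]row_sum_delta.
apply: (big_ind2 (fun a b => N a <= b)); first by rewrite is_norm0.
  by move=> a b a' b' h h'; rewrite (le_trans (is_normD _ _))// lerD.
by move=> i _; rewrite is_normZ.
Qed.

Let major_le : exists2 C, 0 < C &
  forall (r : R) (x : T), (forall i, `|x ord0 i| <= r) -> 0 <= r ->
  major x <= C * r.
Proof.
(* The summand 1 keeps the constant positive when [d = 0]. *)
exists (1 + \sum_(i < d) N (delta_mx ord0 i)).
  by rewrite ltr_pwDl// sumr_ge0// => i _; exact: is_norm_ge0.
move=> r x xr r0; rewrite mulrDl mul1r mulr_suml -[leLHS]add0r lerD//.
rewrite ler_sum// => i _.
by rewrite mulrC ler_wpM2l// is_norm_ge0.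
Qed.

Lemma is_norm_coord_le : exists2 C, 0 < C &
  forall (r : R) (x : T), (forall i, `|x ord0 i| <= r) -> 0 <= r ->
  N x <= C * r.
Proof.
have [C C0 majC] := major_le; exists C => // r x xr r0.
exact: le_trans (norm_major x) (majC _ _ xr r0).
Qed.

(** Each sublevel set is a countable union, over rational vectors [r], of sets on which
    [N r + major (x - r)] is below the level; rational approximation gives one inclusion, the
    triangle inequality the other. *)
Lemma measurable_is_norm : measurable_fun setT N.
Proof.
have [C C0 majC] := major_le.
apply: (measurability _ (RGenInftyO.measurableE R)) => _ [_ [c ->] <-].
rewrite setTI.
pose ratv (r : 'rV[rat]_d) : T := \row_i ratr (r ord0 i).
rewrite (_ : _ @^-1` _ =
    \bigcup_(r in setT) [set x : T | N (ratv r) + major (x - ratv r) < c]).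
  apply: countable_bigcupT_measurable => // r.
  rewrite -[X in measurable X]setTI.
  have : measurable_fun setT (fun x : T => N (ratv r) + major (x - ratv r)).
    apply: measurable_funD => //; apply: measurable_sum => i.
    apply: measurable_funM => //.
    apply: measurableT_comp => //.
    under eq_fun do rewrite !mxE.
    by apply: measurable_funB => //; exact: measurable_coord.
  move=> /(_ measurableT `]-oo, c[%classic); rewrite !setTI => h.
  by have := h (measurable_itv _); congr measurable; apply/seteqP; split => x /=;
     rewrite in_itv.
apply/seteqP; split => x /=; rewrite in_itv/=.
  (* The error [C * e] is incurred twice, once in [N r] and once in [major (x - r)]; a third of the
     gap each keeps the sum below [c]. *)
  move=> Nxc; pose e := (c - N x) / (3 * C).
  have e0 : 0 < e by rewrite divr_gt0 ?subr_gt0 ?mulr_gt0.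
  have ratx i : exists q : rat, ratr q \in `]x ord0 i - e, x ord0 i + e[.
    by apply: rat_in_itvoo; lra.
  exists (\row_i sval (cid (ratx i))) => //=.
  set r := ratv _.
  have Cr : major (x - r) <= C * e.
    apply: majC; last exact: ltW.
    move=> i; rewrite !mxE; case: cid => y /=; rewrite in_itv /= => /andP[y1 y2].
    by rewrite ler_norml; apply/andP; split; lra.
  have Nr : N r <= N x + major (x - r).
    by rewrite -{1}(subKr x r) (le_trans (is_normD _ _))// is_normN lerD.
  have Ce : 3 * (C * e) = c - N x by rewrite /e; field; rewrite gt_eqF.
  have Ce0 : 0 < C * e by rewrite mulr_gt0.
  by lra.
move=> [r _ /=]; apply: le_lt_trans.
by rewrite -{1}(subrK (ratv r) x) addrC (le_trans (is_normD _ _))// lerD.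
Qed.

Lemma is_norm_continuous : continuous N.
Proof.
have [C C0 NC] := is_norm_coord_le.
move=> x; apply/cvgrPdist_le; first exact: (@nbhs_filter T x).
move=> e e0.
have nb : nbhs x (ball x (e / C)) by apply: nbhsx_ballx; rewrite divr_gt0.
apply: filterS nb => y; rewrite -ball_normE /= => /ltW.
rewrite ler_pdivlMr// mulrC => xye.
have Nxy : N (x - y) <= e.
  by apply: le_trans xye; apply: NC => // i; exact: coord_le_norm.
have := is_norm_sub_le x y 0; have := is_norm_sub_le y x 0.
rewrite !subr0 [N (y - x)]is_normC => h1 h2.
by rewrite ler_norml; apply/andP; split; lra.
Qed.

(** The constant is the minimum of [N] over the compact unit sphere of the sup norm. If the sphere
    is empty, 0 is the only vector. *)
Lemma sup_norm_le : exists2 c, 0 < c & forall x : T, c * `|x| <= N x.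
Proof.
pose S := [set x : T | `|x| = 1].
have [[s Ss]|S0] := pselect (S !=set0); last first.
  exists 1 => // x; have [->|x0] := eqVneq x 0.
    by rewrite normr0 mulr0 is_norm_ge0.
  exfalso; apply: S0; exists (`|x|^-1 *: x) => /=.
  by rewrite /S /= mx_normZ normfV normr_id mulVf// normr_eq0.
have cS : compact S.
  apply: bounded_closed_compact.
    exists 1; split => // y y1 x /= ->; exact: ltW.
  apply: (@closed_comp _ _ (fun x : T => `|x|) [set 1]); last exact: closed_eq.
  by move=> x _; exact: norm_continuous.
have [v] := EVT_min_rV (ex_intro _ _ Ss) cS
  (continuous_subspaceT is_norm_continuous).
rewrite inE /S /= => v1 Nv; exists (N v).
  by apply: is_norm_gt0; rewrite -normr_eq0 v1 oner_eq0.
move=> x; have [->|x0] := eqVneq x 0.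
  by rewrite normr0 mulr0 is_norm_ge0.
have := Nv (`|x|^-1 *: x); rewrite inE /S /= mx_normZ normfV normr_id.
rewrite mulVf ?normr_eq0// => /(_ erefl).
by rewrite is_normZ normfV normr_id ler_pdivlMl ?normr_gt0// mulrC.
Qed.

End norm_theory.

Lemma locally_lipschitzP (R : realType) (d : nat) (f : 'rV[R]_d -> R) x :
  locally_lipschitz f -> exists2 L, 0 < L &
  exists2 r, 0 < r & forall y, `|x - y| < r -> `|f x - f y| <= L * `|x - y|.
Proof.
move=> /(_ x)[U Ux [M [_ lipM]]].
have /nbhs_ballP[r /= r0 rU] := Ux.
(* The Lipschitz bound is available for all constants above [M]; this one is also positive. *)
have Mlt : M < `|M| + 1 by rewrite ltr_pwDr// ler_norm.
exists (`|M| + 1); first by rewrite ltr_pwDr.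
exists r => // y xyr; apply: (lipM _ Mlt (x, y)); split => /=.
  exact: nbhs_singleton Ux.
by apply: rU; rewrite -ball_normE.
Qed.

Lemma norm_le_coord (R : realType) (d : nat) (x : 'rV[R]_d) (s : R) :
  0 <= s -> (forall i, `|x ord0 i| <= s) -> `|x| <= s.
Proof.
move=> s0 xs; rewrite [leLHS]/Num.norm /= mx_normrE.
by apply/bigmax_leP; split => // -[i j] _ /=; rewrite (ord1 i).
Qed.

(** A cone whose height equals its radius, so that its slope with respect to [N] is 1. *)
Definition bump (R : realType) (d : nat) (N : 'rV[R]_d -> R) (p : 'rV[R]_d)
  (del : R) (z : 'rV[R]_d) : R := Num.max (del - N (z - p)) 0.

(** * Bumps as test functions for the truncated distance *)

Section bump_theory.
Context (R : realType) (d : nat).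
Local Notation T := 'rV[R]_d.
Local Notation leb := (lebesgue_rV R d).
Variables (N : T -> R) (p : T).
Hypothesis hN : is_norm N.

Lemma measurable_sub_rV : measurable_fun setT (fun z : T * T => z.1 - z.2).
Proof.
apply: measurable_fun_rV => i.
under eq_fun do rewrite !mxE.
apply: measurable_funB.
  apply: (@measurableT_comp _ _ _ _ _ _ (fun x : T => x ord0 i)) => //.
  exact: measurable_coord.
apply: (@measurableT_comp _ _ _ _ _ _ (fun x : T => x ord0 i)) => //.
exact: measurable_coord.
Qed.

Lemma measurable_min1_dist :
  measurable_fun setT (fun z : T * T => min1_dist N z.1 z.2).
Proof.
apply: measurable_minr => //.
exact: (measurableT_comp (measurable_is_norm hN) measurable_sub_rV).
Qed.

Let mNp : measurable_fun setT (fun z : T => N (z - p)).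
Proof.
apply: (measurableT_comp (measurable_is_norm hN)).
exact: (measurableT_comp measurable_sub_rV (measurable_pair2 p)).
Qed.

Lemma measurable_bump del : measurable_fun setT (bump N p del).
Proof. by apply: measurable_maxr => //; exact: measurable_funB. Qed.

Lemma bump_ge0 del z : 0 <= bump N p del z.
Proof. by rewrite le_max lexx orbT. Qed.

Lemma bump_le del z : 0 <= del -> bump N p del z <= del.
Proof. by move=> del0; rewrite ge_max del0 gerBl is_norm_ge0. Qed.

Lemma bump_lipschitz del y z : 0 <= del <= 1 ->
  bump N p del y - bump N p del z <= min1_dist N z y.
Proof.
move=> /andP[del0 del1]; rewrite le_min; apply/andP; split; last first.
  by have := bump_le y del0; have := bump_ge0 del z; lra.
have := is_norm_sub_le hN z y p; have := is_norm_ge0 hN (z - y).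
have := bump_ge0 del z; rewrite lerBlDr {2}/bump ge_max => b0 zy0 h.
have : del - N (z - p) <= bump N p del z by rewrite le_max lexx.
by move=> h'; apply/andP; split; lra.
Qed.

Local Open Scope ereal_scope.

(** The bump vanishes off the ball of radius [del], so domination inside that ball already bounds
    its [mu]-integral by [1 - k] times its [Pi]-integral; duality turns the difference into a lower
    bound. *)
Lemma wasserstein_bump (mu : {measure set T -> \bar R}) (Pi : probability T R)
    (del k : R) : (0 <= del <= 1)%R -> (0 <= k <= 1)%R ->
  (forall A, measurable A -> A `<=` [set z | N (z - p) < del]%R ->
    mu A <= (1 - k)%:E * Pi A) ->
  k%:E * \int[Pi]_z (bump N p del z)%:E <= wasserstein (min1_dist N) mu Pi.
Proof.
move=> del01 k01 muPi; have /andP[del0 del1] := del01; have /andP[k0 k1] := k01.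
pose A0 := [set z | N (z - p) < del]%R.
have mA0 : measurable A0.
  rewrite (_ : A0 = (fun z => N (z - p)) @^-1` `]-oo, del[%classic); last first.
    by apply/seteqP; split => z; rewrite /A0 /= in_itv.
  by rewrite -[X in measurable X]setTI; apply: mNp => //; exact: measurable_itv.
have mb : measurable_fun setT (fun z => (bump N p del z)%:E).
  by apply/measurable_EFinP; exact: measurable_bump.
have b0 z : 0 <= (bump N p del z)%:E by rewrite lee_fin bump_ge0.
have intA0 (m : {measure set T -> \bar R}) :
    \int[m]_z (bump N p del z)%:E = \int[m]_(z in A0) (bump N p del z)%:E.
  rewrite [RHS]integral_mkcond; apply: eq_integral => z _; rewrite patchE.
  case: ifPn => //; rewrite notin_setE /A0 /= => /negP; rewrite -leNgt => h.
  by rewrite /bump; congr EFin; apply/max_idPr; rewrite subr_le0.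
have Pib : \int[Pi]_z (bump N p del z)%:E \is a fin_num.
  rewrite ge0_fin_numE ?integral_ge0//.
  apply: (@le_lt_trans _ _ (\int[Pi]__ del%:E)).
    by apply: ge0_le_integral => // z _; rewrite lee_fin bump_le.
  by rewrite integral_cst// lte_mul_pinfty ?lee_fin// ltey_eq fin_num_measure.
have kk : (0 <= 1 - k)%R by rewrite subr_ge0.
have mub : \int[mu]_z (bump N p del z)%:E <=
    (1 - k)%:E * \int[Pi]_z (bump N p del z)%:E.
  rewrite !intA0 -[leRHS](ge0_integral_mscale Pi mA0 (NngNum kk))//; last first.
    exact: measurable_funTS.
  exact: ge0_le_measure_integral_on.
apply: (@le_trans _ _ (\int[Pi]_z (bump N p del z)%:E -
    \int[mu]_z (bump N p del z)%:E)); last first.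
  apply: wasserstein_ge => //.
  - exact: measurable_min1_dist.
  - by move=> x y; rewrite le_min is_norm_ge0//=.
  - exact: measurable_bump.
  - by move=> x y; exact: bump_lipschitz.
  - apply: le_lt_trans mub _; rewrite ltey_eq fin_numM//.
move: mub; rewrite -(fineK Pib).
have : 0 <= \int[mu]_z (bump N p del z)%:E by apply: integral_ge0.
case: (\int[mu]_z (bump N p del z)%:E) => [m| |] //.
rewrite -EFinB -!EFinM !lee_fin => _; lra.
Qed.

(** On the cube of half-side [s = del / (2 * C)] about [p] the bump is at least [del / 2] and the
    density at least [pi p / 2], and the cube has volume [(del / C) ^+ d]. The product of the three
    is the bound. *)
Lemma integral_bump_ge (Pi : probability T R) (pi : T -> R) :
  has_density Pi pi -> locally_lipschitz pi -> (0 < pi p)%R ->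
  exists2 c : R, (0 < c)%R & exists2 r : R, (0 < r)%R &
  forall del : R, (0 < del <= r)%R ->
  (c * del ^+ d.+1)%:E <= \int[Pi]_z (bump N p del z)%:E.
Proof.
move=> [mpi pi0 PiE] lpi pip.
have [L L0 [r r0 Lr]] := locally_lipschitzP p lpi.
have [C C0 NC] := is_norm_coord_le hN.
exists (pi p / (4 * C ^+ d))%R.
  by rewrite divr_gt0// mulr_gt0// exprn_gt0.
(* The first bound keeps the cube where [pi] is Lipschitz, the second makes [L * s <= pi p / 2]. *)
exists (Num.min (C * r) (C * (pi p / L)))%R.
  by rewrite lt_min; apply/andP; split; rewrite mulr_gt0// divr_gt0.
move=> del /andP[del0]; rewrite le_min => /andP[delr delL].
pose s := (del / (2 * C))%R.
have s0 : (0 < s)%R by rewrite divr_gt0// mulr_gt0.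
have sE : (del = 2 * (C * s))%R by rewrite /s; field; rewrite gt_eqF.
have sr : (s < r)%R.
  rewrite -(ltr_pM2l C0) (lt_le_trans _ delr)// sE.
  by have := mulr_gt0 C0 s0; lra.
have sL : (L * s <= pi p / 2)%R.
  rewrite (_ : (pi p / 2 = L * (pi p / L / 2))%R); last by field; rewrite gt_eqF.
  rewrite ler_pM2l// ler_pdivlMr// -(ler_pM2l C0) (le_trans _ delL)// sE.
  by have := mulr_gt0 C0 s0; lra.
pose B (i : 'I_d) := `[p ord0 i - s, p ord0 i + s]%classic%R.
pose box := [set z : T | forall i, B i (z ord0 i)].
have Bz z i : box z -> (`|(z - p) ord0 i| <= s)%R.
  move=> /(_ i); rewrite /B /= in_itv/= !mxE ler_norml => /andP[? ?].
  by apply/andP; split; lra.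
have mbox : measurable box.
  have -> : box = \bigcap_i [set z : T | B i (z ord0 i)].
    by apply/seteqP; split=> z /= h => [i _|i]; exact: h.
  apply: fin_bigcap_measurable => // i _.
  rewrite -[X in measurable X]setTI; apply: measurable_coord => //.
  exact: measurable_itv.
have lebbox : leb box = ((2 * s) ^+ d)%:E.
  rewrite lebesgue_rV_box; last by move=> i; exact: measurable_itv.
  rewrite (eq_bigr (fun _ => (2 * s)%:E)); last first.
    move=> i _; rewrite lebesgue_measure_itv/= lte_fin.
    rewrite ifT; first by rewrite -EFinB; congr EFin; ring.
    by lra.
  by rewrite prodEFin big_const_ord iter_mulr_1.
have pibox z : box z -> (pi p / 2 <= pi z)%R.
  move=> zb; have zps : (`|p - z| <= s)%R.
    by rewrite distrC norm_le_coord ?(ltW s0)// => i; exact: Bz.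
  have := Lr z (le_lt_trans zps sr).
  have : (L * `|p - z| <= L * s)%R by rewrite ler_pM2l.
  by rewrite ler_norml => h /andP[_ h']; lra.
have bbox z : box z -> (del / 2 <= bump N p del z)%R.
  move=> zb; have : (N (z - p) <= C * s)%R.
    by apply: NC; [move=> i; exact: Bz|exact: ltW].
  by move=> h; rewrite le_max; apply/orP; left; lra.
have mb : measurable_fun setT (fun z => (bump N p del z)%:E).
  by apply/measurable_EFinP; exact: measurable_bump.
apply: (@le_trans _ _ (\int[Pi]_(z in box) (bump N p del z)%:E)); last first.
  by apply: ge0_subset_integral => // z _; rewrite lee_fin bump_ge0.
apply: (@le_trans _ _ (\int[Pi]_(z in box) (del / 2)%:E)); last first.
  apply: ge0_le_integral => //.
  - by move=> z _; rewrite lee_fin divr_ge0// ltW.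
  - exact: measurable_funTS.
rewrite integral_cst// [X in _ * X](_ : _ = \int[leb]_(z in box) (pi z)%:E);
  last exact: PiE.
apply: (@le_trans _ _ ((del / 2)%:E * \int[leb]_(z in box) (pi p / 2)%:E)).
  rewrite integral_cst// [X in _ * (_ * X)](_ : _ = ((2 * s) ^+ d)%:E)//.
  rewrite -!EFinM lee_fin.
  rewrite (_ : (2 * s = del / C)%R); last by rewrite sE; field; rewrite gt_eqF.
  rewrite expr_div_n exprS le_eqVlt; apply/orP; left; apply/eqP; field.
  by rewrite expf_neq0// gt_eqF.
rewrite lee_pmul2l ?fin_numE//; last by rewrite lte_fin divr_gt0.
apply: ge0_le_integral => //.
- by move=> z _; rewrite lee_fin divr_ge0// ltW.
- by apply: measurable_funTS; exact/measurable_EFinP.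
Qed.

End bump_theory.

(** * Convergence rate *)

(** From [ln x = 2 * ln (sqrt x)]; it makes [ln t / t] of order [1 / sqrt t]. *)
Lemma ln_le_sqrt (R : realType) (x : R) : 0 < x -> ln x <= 2 * Num.sqrt x.
Proof.
move=> x0; have s0 : 0 < Num.sqrt x by rewrite sqrtr_gt0.
have -> : ln x = 2 * ln (Num.sqrt x).
  by rewrite -[in LHS](sqr_sqrtr (ltW x0)) lnXn// mulr_natl.
rewrite ler_pM2l// -[in leLHS](subrKC 1 (Num.sqrt x)).
by rewrite (le_trans (le_ln1Dx _))//; lra.
Qed.

(** The root of the lower bound is [rho * expR ((ln K - m * ln t) / t)], and [1 + y <= expR y]
    reduces it to an explicit sequence tending to [rho]. *)
Lemma cvg_root_sandwich (R : realType) (K rho : R) (m : nat)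
    (w : nat -> \bar R) :
  0 < K -> 0 < rho ->
  (forall t, (0 < t)%N ->
    ((K * rho ^+ t / t%:R ^+ m)%:E <= w t <= (rho ^+ t)%:E)%E) ->
  (w t `^ (t%:R^-1))%E @[t --> \oo] --> rho%:E.
Proof.
move=> K0 rho0 Kw.
(* With [v = sqrt t >= 1], [ln K >= - |ln K| * v] and [m * ln t <= 2 * m * v], so the exponent is at
   least [- c / v]. *)
pose c := `|ln K| + m%:R * 2.
apply: (@squeeze_cvge _ _ _ R (fun t => (rho * (1 - c * Num.sqrt (t%:R^-1)))%:E)
  _ (fun=> rho%:E)); last 2 first.
- apply: cvg_EFin; first exact: nearW.
  rewrite -[X in _ --> X](_ : rho * (1 - c * 0) = rho); last first.
    by rewrite mulr0 subr0 mulr1.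
  apply: cvgM; first exact: cvg_cst.
  apply: cvgB; first exact: cvg_cst.
  apply: cvgM; first exact: cvg_cst.
  have cV : (t%:R^-1 : R) @[t --> \oo] --> (0 : R).
    by rewrite -cvg_shiftS; exact: cvg_harmonic.
  by rewrite -sqrtr0; apply: continuous_cvg => //; exact: sqrt_continuous.
- exact: cvg_cst.
near=> t.
have t0 : (0 < t)%N by near: t; exists 1%N.
have tR : 0 < t%:R :> R by rewrite ltr0n.
have /andP[Kt tw] := Kw t t0.
have rt0 : 0 < rho ^+ t by rewrite exprn_gt0.
have root (a : R) : 0 <= a -> ((a ^+ t)%:E `^ (t%:R^-1))%E = a%:E.
  move=> a0; rewrite poweR_EFin -powR_mulrn// -powRrM mulfV ?powRr1//.
  exact: lt0r_neq0.
have L0 : 0 < K * rho ^+ t / t%:R ^+ m.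
  by rewrite divr_gt0 ?mulr_gt0// exprn_gt0.
have w0 : (0 <= w t)%E by rewrite (le_trans _ Kt)// lee_fin ltW.
have ti : 0 <= t%:R^-1 :> R by rewrite invr_ge0.
apply/andP; split; last first.
  rewrite -(root rho (ltW rho0)); apply: gt0_ler_poweR => //;
    by rewrite in_itv/= leey andbT ?w0 ?lee_fin ?ltW.
apply: (@le_trans _ _ ((K * rho ^+ t / t%:R ^+ m)%:E `^ (t%:R^-1))%E);
  last first.
  by apply: gt0_ler_poweR => //; rewrite in_itv/= leey andbT ?w0 ?lee_fin ?ltW.
rewrite poweR_EFin lee_fin /powR gt_eqF//.
have -> : t%:R^-1 * ln (K * rho ^+ t / t%:R ^+ m) =
    ln rho + t%:R^-1 * (ln K - m%:R * ln t%:R).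
  have lnrho : ln (rho ^+ t) = t%:R * ln rho by rewrite lnXn// mulr_natl.
  have lnt : ln (t%:R ^+ m) = m%:R * ln t%:R :> R by rewrite lnXn// mulr_natl.
  rewrite lnM ?posrE ?invr_gt0 ?mulr_gt0 ?exprn_gt0//.
  rewrite lnM ?posrE ?exprn_gt0// lnV ?posrE ?exprn_gt0// lnrho lnt.
  by rewrite !mulrDr [_^-1 * (_ * ln rho)]mulrA mulVf ?gt_eqF// mul1r; ring.
rewrite expRD lnK ?posrE// ler_pM2l//; apply: le_trans (expR_ge1Dx _).
rewrite lerD2l sqrtrV//; set v := Num.sqrt _.
have v1 : 1 <= v by rewrite -sqrtr1 ler_wsqrtr// ler1n.
have v0 : 0 < v by rewrite (lt_le_trans _ v1).
have tE : t%:R = v ^+ 2 :> R by rewrite sqr_sqrtr.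
have lnt := ln_le_sqrt tR.
have mlnt : m%:R * ln t%:R <= m%:R * (2 * v) :> R by rewrite ler_wpM2l.
have lnKv : - `|ln K| * v <= ln K.
  rewrite mulNr lerNl; have := ler_norm (- ln K); rewrite normrN.
  move=> /le_trans; apply.
  by rewrite ler_peMr.
rewrite tE.
rewrite ler_pdivlMl ?exprn_gt0// (_ : v ^+ 2 * _ = - c * v); last first.
  by field; rewrite gt_eqF.
rewrite tE in mlnt; rewrite /c; lra.
Unshelve. all: by end_near. Qed.

Lemma ratio_near_min (R : realType) (d : nat) (pi q : 'rV[R]_d -> R) p
    (eps : R) :
  locally_lipschitz pi -> locally_lipschitz q ->
  0 <= eps -> 0 < pi p -> q p = eps * pi p ->
  exists2 r, 0 < r & exists2 a, 0 < a & forall u y, 0 <= u ->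
    `|p - y| < r -> `|p - y| <= a * u -> 0 < pi y /\ q y <= (eps + u) * pi y.
Proof.
move=> lpi lq eps0 pip qp.
have [L1 L10 [r1 r10 lip1]] := locally_lipschitzP p lpi.
have [L2 L20 [r2 r20 lip2]] := locally_lipschitzP p lq.
have L0 : 0 < L2 + eps * L1 by rewrite ltr_pwDl// mulr_ge0// ltW.
(* The last bound keeps [pi y >= pi p / 2]. *)
exists (Num.min (Num.min r1 r2) (pi p / L1 / 2)).
  by rewrite !lt_min r10 r20/= !divr_gt0.
(* [q - eps * pi] vanishes at [p] and grows at most at rate [L2 + eps * L1]; it must stay below
   [u * pi p / 2]. *)
exists (pi p / 2 / (L2 + eps * L1)); first by rewrite !divr_gt0.
move=> u y u0; rewrite !lt_min => /andP[/andP[yr1 yr2] yL] ya.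
move: (lip1 y yr1) (lip2 y yr2); set h := `|p - y| in yL ya *.
rewrite !ler_norml => /andP[_ hpi] /andP[hq _].
have piy : pi p / 2 <= pi y.
  have : L1 * h <= L1 * (pi p / L1 / 2) by rewrite ler_pM2l// ltW.
  rewrite (_ : L1 * (pi p / L1 / 2) = pi p / 2); first by move=> ?; lra.
  by field; rewrite gt_eqF.
split; first by rewrite (lt_le_trans _ piy)// divr_gt0.
have Lh : (L2 + eps * L1) * h <= pi p / 2 * u.
  have -> : pi p / 2 * u = (L2 + eps * L1) * (pi p / 2 / (L2 + eps * L1) * u).
    by field; rewrite gt_eqF.
  by rewrite ler_pM2l.
have h1 : u * (pi p / 2) <= u * pi y by rewrite ler_wpM2l.
have h2 : eps * (pi p - pi y) <= eps * (L1 * h) by rewrite ler_wpM2l.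
by move: hq; rewrite qp => hq; lra.
Qed.

(** The inequality [P <= Q] applied to the complement reverses, both masses being 1. *)
Lemma le_density_eq (R : realType) (d : nat) (P Q : probability 'rV[R]_d R)
    (f g : 'rV[R]_d -> R) :
  has_density P f -> has_density Q g -> (forall x, f x <= g x) ->
  forall A, measurable A -> Q A = P A.
Proof.
move=> [mf f0 PE] [mg g0 QE] fg.
have PQ B : measurable B -> (P B <= Q B)%E.
  move=> mB; rewrite PE// QE//; apply: ge0_le_integral => //.
  - by move=> x _; rewrite lee_fin.
  - by apply: measurable_funTS; exact/measurable_EFinP.
  - by apply: measurable_funTS; exact/measurable_EFinP.
  - by move=> x _; rewrite lee_fin.
move=> A mA; apply/eqP; rewrite eq_le PQ// andbT.
have := PQ _ (measurableC mA); rewrite !probability_setC//.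
have PA : P A \is a fin_num by exact: fin_num_measure.
have QA : Q A \is a fin_num by exact: fin_num_measure.
by rewrite -(fineK PA) -(fineK QA) -!EFinB !lee_fin; lra.
Qed.

(** Used to rule out a one-point support: [Pi] and [Q] would then be the same Dirac measure. No case
    distinction on [d] is made, so [d = 0] is covered. *)
Lemma dirac_density (R : realType) (d : nat) (P : probability 'rV[R]_d R)
    (f : 'rV[R]_d -> R) p :
  has_density P f -> (forall x, x != p -> f x = 0) ->
  forall A, measurable A -> P A = \d_p A.
Proof.
move=> [mf f0 PE] fp A mA.
have P0 B : measurable B -> ~ B p -> P B = 0%E.
  move=> mB Bp; rewrite PE// integral0_eq// => x Bx.
  by rewrite fp//; apply: contra_not_neq Bp => <-.
have [Ap|Ap] := pselect (A p); last by rewrite P0// diracE memNset.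
rewrite diracE mem_set//; apply/eqP; rewrite eq_le probability_le1//=.
have := P0 _ (measurableC mA) (fun h => h Ap); rewrite probability_setC//.
have PA : P A \is a fin_num by exact: fin_num_measure.
by rewrite -(fineK PA) -EFinB lee_fin => -[/eqP]; rewrite subr_eq0 => /eqP <-.
Qed.

Theorem theorem3 (R : realType) (d : nat) (Theta : set 'rV[R]_d)
    (Pi Q : probability 'rV[R]_d R) (pi q : 'rV[R]_d -> R)
    (N : 'rV[R]_d -> R) (thetas : 'rV[R]_d)
    (mTheta : measurable Theta) (Theta0 : Theta !=set0)
    (QPi : ~ (forall A, measurable A -> Q A = Pi A))
    (hpi : has_density Pi pi) (hq : has_density Q q)
    (spi : has_support pi Theta) (sq : has_support q Theta)
    (hN : is_norm N)
    (lpi : locally_lipschitz pi) (lq : locally_lipschitz q)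
    (bpi : [bounded pi x | x in setT]) (bq : [bounded q x | x in setT])
    (hthetas : Theta thetas)
    (hmin : forall x, Theta x -> q thetas / pi thetas <= q x / pi x) :
  forall theta, Theta theta ->
    wasserstein_root (min1_dist N) (mhi hpi hq) Pi theta @ \oo -->
      (1 - q thetas / pi thetas)%:E /\
    wasserstein_rate (min1_dist N) (mhi hpi hq) Pi theta =
      (1 - q thetas / pi thetas)%:E.
Proof.
move=> x Tx; set eps := q thetas / pi thetas.
have [pi_gt0 pi_0] := spi; have [q_gt0 q_0] := sq.
have pis : 0 < pi thetas by exact: pi_gt0.
have eps0 : 0 < eps by rewrite divr_gt0// q_gt0.
have qs : q thetas = eps * pi thetas by rewrite divfK ?gt_eqF.
have epsq y : eps * pi y <= q y.
  have [Ty|Ty] := pselect (Theta y); last by rewrite pi_0// q_0// mulr0.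
  by rewrite -ler_pdivlMr ?pi_gt0// hmin.
(* Otherwise [pi <= q] everywhere, which forces [Q = Pi]. *)
have eps1 : eps < 1.
  rewrite ltNge; apply/negP => eps1; apply: QPi; apply: (le_density_eq hpi hq).
  move=> y; apply: le_trans (epsq y); rewrite ler_peMl//.
  by case: hpi => _ /(_ y).
pose rho := 1 - eps; have rho0 : 0 < rho by rewrite subr_gt0.
have rho1 : rho < 1 by rewrite /rho; lra.
pose W t := wasserstein (min1_dist N) (kernel_pow (mhi hpi hq) t x) Pi.
have W_le t : (W t <= (rho ^+ t)%:E)%E.
  apply: wasserstein_le.
  - exact: prob_kernel.
  - by rewrite exprn_ge0 ?exprn_ile1// ltW.
  - exact: measurable_min1_dist.
  - move=> y z; rewrite le_min is_norm_ge0//= ler01/=.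
    by rewrite ge_min lexx orbT.
  - by move=> y; rewrite /min1_dist subrr is_norm0//; apply/min_idPl.
  - by move=> A mA; apply: mhi_pow_minor => //; exact: ltW.
have [K K0 W_ge] : exists2 K, 0 < K & forall t, (0 < t)%N ->
    ((K * rho ^+ t / t%:R ^+ d.+1)%:E <= W t)%E.
  have [xs|xs] := eqVneq x thetas.
    have [p [Tp ps]] : exists p, Theta p /\ p != thetas.
      apply: contrapT => noP; apply: QPi => A mA.
      have out y : y != thetas -> ~ Theta y by move=> ys Ty; apply: noP; exists y.
      rewrite (dirac_density hq (p := thetas))//; last by move=> y /out; exact: q_0.
      by rewrite (dirac_density hpi (p := thetas))// => y /out; exact: pi_0.
    have [c c0 [r r0 cr]] := integral_bump_ge hN hpi lpi (pi_gt0 p Tp).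
    (* The last bound keeps the atom at [x = thetas] out of the ball about [p]. *)
    pose del := Num.min (Num.min 1 r) (N (thetas - p)).
    have Np : 0 < N (thetas - p) by rewrite is_norm_gt0// subr_eq0 eq_sym.
    have del0 : 0 < del by rewrite !lt_min ltr01 r0.
    have [del1 delr delN] : [/\ del <= 1, del <= r & del <= N (thetas - p)].
      by split; rewrite !ge_min lexx ?orbT.
    exists (c * del ^+ d.+1); first by rewrite mulr_gt0// exprn_gt0.
    move=> t t0; have rt0 : 0 <= rho ^+ t by rewrite exprn_ge0// ltW.
    apply: le_trans (@wasserstein_bump _ _ N p hN _ _ del (rho ^+ t) _ _ _).
    (* The polynomial factor only weakens the bound here; it gives both cases the same form. *)
    - apply: (@le_trans _ _ ((rho ^+ t)%:E * (c * del ^+ d.+1)%:E)%E).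
        rewrite -EFinM lee_fin [leRHS]mulrC ler_pdivrMr ?exprn_gt0 ?ltr0n//.
        apply: ler_peMr; last by rewrite exprn_ege1// ler1n.
        by apply: mulr_ge0 => //; rewrite mulr_ge0 ?exprn_ge0// ltW.
      by rewrite lee_wpmul2l ?lee_fin// cr// del0.
    - by rewrite (ltW del0).
    - by rewrite rt0 exprn_ile1// ltW.
    - move=> A mA AN.
      rewrite xs (mhi_pow_at_min _ _ (ltW eps0) epsq _ (ltW eps1) pis qs mA).
      rewrite diracE memNset ?mule0 ?adde0// => /AN /=.
      by rewrite ltNge delN.
  have [r r0 [a a0 near]] := ratio_near_min lpi lq (ltW eps0) pis qs.
  have [c c0 [r' r'0 cr']] := integral_bump_ge hN hpi lpi pis.
  have [C C0 supN] := sup_norm_le hN.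
  have Nx : 0 < N (x - thetas) by rewrite is_norm_gt0// subr_eq0.
  (* In order: admissibility of the bump, validity of its integral bound, exclusion of [x] from the
     ball, and, via [supN], the two distance conditions of [ratio_near_min] for a ball of radius
     [b / t]. *)
  pose b := Num.min (Num.min 1 r') (Num.min (N (x - thetas))
    (Num.min (C * r) (C * (a * (rho / 4))))).
  have b0 : 0 < b by rewrite !lt_min ltr01 r'0 Nx !mulr_gt0//= divr_gt0.
  have [[b1 br'] [bN [bCr bCa]]] : (b <= 1 /\ b <= r') /\
      (b <= N (x - thetas) /\ (b <= C * r /\ b <= C * (a * (rho / 4)))).
    by rewrite !ge_min !lexx !orbT.
  exists (c * b ^+ d.+1 / 2); first by rewrite divr_gt0// mulr_gt0// exprn_gt0.
  move=> t t0; have tR : 0 < t%:R :> R by rewrite ltr0n.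
  have rt0 : 0 <= rho ^+ t by rewrite exprn_ge0// ltW.
  have t1 : 1 <= t%:R :> R by rewrite ler1n.
  (* This makes [2 * t * u = rho / 2], so half of the deficit [rho ^+ t] survives; [del] shrinks in
     proportion to [u]. *)
  pose del := b / t%:R; pose u := rho / 4 / t%:R.
  have del0 : 0 < del by rewrite divr_gt0.
  have delb : del <= b by rewrite ler_pdivrMr// ler_peMr// ltW.
  have u0 : 0 <= u by rewrite !divr_ge0// ltW.
  have tu : (t * 2)%:R * u = rho / 2.
    by rewrite natrM /u; field; rewrite gt_eqF.
  have w2 : 1 - (t * 2)%:R * u / rho = 2^-1.
    by rewrite tu; field; rewrite gt_eqF.
  have nearA y : N (y - thetas) < del -> 0 < pi y /\ q y <= (eps + u) * pi y.
    move=> yd; have := supN (thetas - y); rewrite [N _]is_normC// => Cy.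
    apply: near => //.
      by rewrite -(ltr_pM2l C0); apply: le_lt_trans Cy _; lra.
    rewrite -(ler_pM2l C0) (le_trans Cy)// (le_trans (ltW yd))//.
    rewrite (_ : C * (a * u) = C * (a * (rho / 4)) / t%:R); last first.
      by rewrite /u !mulrA.
    by rewrite ler_pM2r ?invr_gt0.
  apply: le_trans (@wasserstein_bump _ _ N thetas hN _ _ del (rho ^+ t / 2) _ _ _).
  - apply: (@le_trans _ _ ((rho ^+ t / 2)%:E * (c * del ^+ d.+1)%:E)%E).
      rewrite -EFinM lee_fin /del expr_div_n le_eqVlt; apply/orP; left; apply/eqP.
      by field; rewrite expf_neq0// gt_eqF.
    rewrite lee_wpmul2l ?lee_fin ?divr_ge0// cr'// del0/=.
    exact: le_trans br'.
  - by rewrite (ltW del0)/= (le_trans delb).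
  - have : rho ^+ t <= 1 by rewrite exprn_ile1// ltW.
    by move=> ?; apply/andP; split; lra.
  - move=> A mA AN.
    rewrite -w2; apply: (@mhi_pow_deficit _ _ _ _ _ _ hpi hq _ _ _ u x
      [set z | N (z - thetas) < del]) => //.
    + exact: ltW.
    + by rewrite /= => /lt_le_trans/(_ (le_trans delb bN)); rewrite ltxx.
    + by move=> y /nearA[].
    + by move=> y /nearA[].
    + by rewrite tu -/rho; lra.
have root : wasserstein_root (min1_dist N) (mhi hpi hq) Pi x @ \oo --> rho%:E.
  apply: (cvg_root_sandwich (w := W) (m := d.+1) K0 rho0) => t t0.
  by rewrite W_ge// W_le.
by split=> //; exact/cvg_lim.
Qed.
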